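(* Let $x,y,z_1,z_2,z_3$ be indeterminates. For every integer $n\ge 3$, the triply-refined ASM generating function satisfies $$\begin{aligned} &(z_2-z_1)(z_3-1)\,Z^{\mathrm{tri}}_n(x,y;z_1,z_2,z_3)\,Z_{n-2}(x,y)=\\ &\bigl((z_2-1)(z_3-1)-yz_2z_3\bigr)\,z_1\,Z^{\mathrm{adj}}_{n-1}(x,y;z_1,z_3)\,Z_{n-1}(x,y;z_2)\\ &-\bigl(x(z_1-1)(z_3-1)-y\bigr)\,z_1z_2z_3\,\widetilde{Z}^{\mathrm{adj}}_{n-1}(x,y;z_2,z_3)\,Z_{n-1}(x,y;z_1)\\ &-(z_1-1)(z_3-1)\,z_2\,Z_{n-1}(x,y;z_2)\,Z_{n-2}(x,y)\\ &+(z_2-1)(z_3-1)\,z_1\,(xz_2z_3)^{n-1}\,Z_{n-1}(x,y;z_1)\,Z_{n-2}(x,y). \end{aligned}$$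
   Context: An alternating sign matrix (ASM) is a square matrix with entries in $\{0,1,-1\}$ such that along each row and each column the nonzero entries alternate in sign and sum to $1$. $\mathrm{ASM}(n)$ is the set of $n\times n$ ASMs. The first and last rows and columns of an ASM each contain exactly one $1$, all other entries there being $0$. For $A\in\mathrm{ASM}(n)$ define: $\nu(A)=\sum_{1\le i<i'\le n,\;1\le j'\le j\le n}A_{ij}A_{i'j'}$ (a nonnegative integer); $\mu(A)=$ number of $-1$'s in $A$; $\rho_{\mathrm T}(A)=$ number of $0$'s to the left of the $1$ in the top row; $\rho_{\mathrm R}(A)=$ number of $0$'s below the $1$ in the right-most column; $\rho_{\mathrm B}(A)=$ number of $0$'s to the right of the $1$ in the bottom row; $\rho_{\mathrm L}(A)=$ number of $0$'s above the $1$ in the left-most column. Generating functions (for $n\ge1$): $Z^{\mathrm{quad}}_n(x,y;z_1,z_2,z_3,z_4)=\sum_{A\in\mathrm{ASM}(n)}x^{\nu(A)}y^{\mu(A)}z_1^{\rho_{\mathrm T}(A)}z_2^{\rho_{\mathrm R}(A)}z_3^{\rho_{\mathrm B}(A)}z_4^{\rho_{\mathrm L}(A)}$; $Z^{\mathrm{tri}}_n(x,y;z_1,z_2,z_3)=Z^{\mathrm{quad}}_n(x,y;z_1,1,z_2,z_3)$; $Z^{\mathrm{adj}}_n(x,y;z_1,z_2)=Z^{\mathrm{quad}}_n(x,y;z_1,1,1,z_2)$; $\widetilde{Z}^{\mathrm{adj}}_n(x,y;z_1,z_2)=Z^{\mathrm{quad}}_n(x,y;z_1,z_2,1,1)$;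 $Z_n(x,y;z)=Z^{\mathrm{quad}}_n(x,y;z,1,1,1)$; $Z_n(x,y)=Z^{\mathrm{quad}}_n(x,y;1,1,1,1)$. *)

(* Defs.v *)
From mathcomp Require Import all_boot all_order all_algebra.
From mathcomp Require Export mpoly.

Set Implicit Arguments.
Unset Strict Implicit.
Unset Printing Implicit Defensive.

Import Order.TTheory GRing.Theory Num.Theory.
Local Open Scope ring_scope.

Definition asm_entries : seq int := [:: 0; 1; -1].

Definition alternating_line (s : seq int) : bool :=
  [&& all (mem asm_entries) s,
      sorted (fun a b : int => b == - a) [seq a <- s | a != 0]
    & \sum_(a <- s) a == 1].

Definition is_asm (n : nat) (A : 'M[int]_n) : bool :=
  [forall i, alternating_line [seq A i j | j <- enum 'I_n]]
  && [forall j, alternating_line [seq A i j | i <- enum 'I_n]].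

(* ['M[int]_n] is not a finite type, so ASM(n) is enumerated through the finite
   type of matrices with entries in [asm_entries]; [mem_ASM] and [ASM_uniq]
   show that each alternating sign matrix is listed exactly once. *)
Definition ASM (n : nat) : seq 'M[int]_n :=
  [seq A <- [seq map_mx val B | B : 'M[seq_sub asm_entries]_n] | is_asm A].

Lemma mem_ASM (n : nat) (A : 'M[int]_n) : (A \in ASM n) = is_asm A.
Proof.
rewrite mem_filter andb_idr // => /andP[/forallP Arow _].
have Ae i j : A i j \in asm_entries.
  have /and3P[/allP Ai _ _] := Arow i.
  by apply: Ai; apply/mapP; exists j; rewrite ?mem_enum.
apply/imageP; exists (\matrix_(i, j) SeqSub (Ae i j)) => //.
by apply/matrixP => i j; rewrite !mxE.
Qed.

Lemma ASM_uniq (n : nat) : uniq (ASM n).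
Proof.
apply: filter_uniq; rewrite map_inj_uniq ?enum_uniq // => B C /matrixP BC.
by apply/matrixP => i j; apply: val_inj; have := BC i j; rewrite !mxE.
Qed.

Definition nu (n : nat) (A : 'M[int]_n) : int :=
  \sum_(i < n) \sum_(i' < n | (i < i')%N)
    \sum_(j < n) \sum_(j' < n | (j' <= j)%N) A i j * A i' j'.

Definition mu (n : nat) (A : 'M[int]_n) : nat :=
  #|[set p : 'I_n * 'I_n | A p.1 p.2 == -1]|.

Definition rho_T (n : nat) (A : 'M[int]_n.+1) : nat :=
  #|[set k | (A ord0 k == 0) && [exists j, (A ord0 j == 1) && (k < j)%N]]|.

Definition rho_R (n : nat) (A : 'M[int]_n.+1) : nat :=
  #|[set k | (A k ord_max == 0)
             && [exists i, (A i ord_max == 1) && (i < k)%N]]|.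

Definition rho_B (n : nat) (A : 'M[int]_n.+1) : nat :=
  #|[set k | (A ord_max k == 0)
             && [exists j, (A ord_max j == 1) && (j < k)%N]]|.

Definition rho_L (n : nat) (A : 'M[int]_n.+1) : nat :=
  #|[set k | (A k ord0 == 0) && [exists i, (A i ord0 == 1) && (k < i)%N]]|.

Lemma alt_partial_sum (a : int) (s : seq int) (k : nat) :
  a \in [:: 0; 1] -> all (mem asm_entries) s ->
  path (fun b c : int => c == - b) (if a == 0 then -1 else 1)
       [seq b <- s | b != 0] ->
  0 <= a + \sum_(b <- take k s) b.
Proof.
elim: s a k => [|b s IH] a [|k] a01 /=;
  do ?by rewrite big_nil addr0; move: a01; rewrite !inE => /orP[] /eqP->.
rewrite big_cons addrA => /andP[+ hs]; rewrite !inE.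
move: a01; rewrite !inE => /orP[] /eqP-> /or3P[] /eqP -> //= hp;
  by apply: IH.
Qed.

Lemma alternating_line_partial_sum (s : seq int) (k : nat) :
  alternating_line s -> 0 <= \sum_(a <- take k s) a.
Proof.
case/and3P => hs hsort hsum.
have [hp|hn] := boolP (path (fun b c : int => c == - b) (-1)
                            [seq b <- s | b != 0]).
  by have := @alt_partial_sum 0 s k _ hs hp; rewrite add0r; apply.
have: 0 <= 0 + \sum_(b <- take (size s) (map -%R s)) b.
  apply: alt_partial_sum => //.
    rewrite all_map; apply: sub_all hs => b.
    by rewrite /= !inE => /or3P[] /eqP->.
  rewrite eqxx filter_map.
  rewrite (@eq_filter _ _ (fun b : int => b != 0)); last first.
    by move=> b; rewrite /= oppr_eq0.
  have: all (mem asm_entries) [seq b <- s | b != 0].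
    by apply/allP => b; rewrite mem_filter => /andP[_]; apply: (allP hs).
  have: all (fun b => b != 0) [seq b <- s | b != 0] by exact: filter_all.
  move: hsort hn; case: [seq b <- s | b != 0] => //= b t hbt.
  rewrite hbt andbT => b1 /andP[b0 _] /andP[+ _].
  rewrite !inE (negPf b0) /= => /orP[] /eqP be; first by rewrite be in b1.
  rewrite {}be in hbt *; rewrite eqxx /=.
  by rewrite path_map; apply: sub_path hbt => u v /= /eqP->.
by rewrite -(size_map -%R s) take_size big_map sumrN (eqP hsum).
Qed.

Lemma nu_ge0 (n : nat) (A : 'M[int]_n) : is_asm A -> 0 <= nu A.
Proof.
case/andP => /forallP hr /forallP hc; rewrite /nu.
have -> : \sum_(i < n) \sum_(i' < n | (i < i')%N)
    \sum_(j < n) \sum_(j' < n | (j' <= j)%N) A i j * A i' j' =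
    \sum_(i' < n) \sum_(j < n) (\sum_(i < n | (i < i')%N) A i j)
       * (\sum_(j' < n | (j' <= j)%N) A i' j').
  rewrite (exchange_big_dep xpredT) //=; apply: eq_bigr => i' _.
  rewrite exchange_big /=; apply: eq_bigr => j _.
  by rewrite mulr_suml; apply: eq_bigr => i _; rewrite mulr_sumr.
have part (f : 'I_n -> int) (k : nat) :
    alternating_line [seq f j | j <- enum 'I_n] ->
    0 <= \sum_(j < n | (j < k)%N) f j.
  move/(alternating_line_partial_sum k); rewrite -map_take big_map.
  suff -> : take k (enum 'I_n) = [seq j : 'I_n <- enum 'I_n | (j < k)%N].
    by rewrite big_filter big_enum_cond.
  apply: (inj_map val_inj); rewrite map_take val_enum_ord.
  rewrite -(filter_map val (fun j => (j < k)%N)) val_enum_ord.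
  rewrite take_iota -(filter_iota_ltn 0 (geq_minr k n)).
  apply: eq_in_filter => j; rewrite mem_iota ltn_min => /andP[_ ->].
  by rewrite andbT.
apply: sumr_ge0 => i' _; apply: sumr_ge0 => j _; apply: mulr_ge0.
  exact: part (hc j).
exact: part (fun j => A i' j) j.+1 (hr i').
Qed.

(* [nu A] is nonnegative on ASM(n) by [nu_ge0], so the absolute value only casts
   it to [nat]. The value at [n = 0] is a dummy: the statistics [rho_*] require
   a nonempty matrix. *)
Definition Z_quad (R : comNzRingType) (n : nat) (x y z1 z2 z3 z4 : R) : R :=
  if n is m.+1 then
    \sum_(A <- ASM m.+1)
      x ^+ `|nu A|%N * y ^+ mu A
      * z1 ^+ rho_T A * z2 ^+ rho_R A * z3 ^+ rho_B A * z4 ^+ rho_L A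
  else 1.

Definition Z_tri (R : comNzRingType) (n : nat) (x y z1 z2 z3 : R) : R :=
  Z_quad n x y z1 1 z2 z3.

Definition Z_adj (R : comNzRingType) (n : nat) (x y z1 z2 : R) : R :=
  Z_quad n x y z1 1 1 z2.

Definition Z_adj_tilde (R : comNzRingType) (n : nat) (x y z1 z2 : R) : R :=
  Z_quad n x y z1 z2 1 1.

Definition Z_ref (R : comNzRingType) (n : nat) (x y z : R) : R :=
  Z_quad n x y z 1 1 1.

Definition Z_unref (R : comNzRingType) (n : nat) (x y : R) : R :=
  Z_quad n x y 1 1 1 1.

(* Main.v *)
(* Alternating sign matrices are the states of the six-vertex model with domain
   wall boundary conditions.  Giving every row and column a spectral parameter,
   the partition function is symmetric in the row parameters (Yang-Baxter) and
   factorizes when a corner weight vanishes; Lagrange interpolation in the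
   parameter of the first column then yields the Izergin-Korepin determinant.
   The Desnanot-Jacobi identity turns this determinant into a bilinear relation
   between the partition functions of sizes n, n-1 and n-2.  Specializing the
   parameters of the first row, the last row and the first column to z1, z2, z3
   and all the others to 1, the partition functions become the refined generating
   functions, except that the weights of the two left corners are not those
   prescribed by z1, z2, z3: correcting them produces the last two terms. *)

(* Where a line of parameter r crosses a line of parameter 1, the zeros weigh y or y r (up to the
   factor x), exactly what a refinement by r requires. The weights deviate only where two refined
   lines cross. The two refined rows meet the refined column at the two left corners, hence two
   corrections. The partition function is affine in each of the two corner weights, so the
   coefficient of their product, which has no closed form, can be eliminated. The Jacobi identity
   singles out the first two rows, whereas the refinement concerns the first and the last: symmetry
   in the rows moves the parameter of the last row to the second place. The main obstacle is that
   the determinant is singular at the desired specialization, where most rows and columns share the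
   parameter 1, and that interpolation needs divisions. Hence the detour through a fraction field
   and perturbed parameters. Every nonvanishing condition met on the way is certified by a morphism
   to the integers with x = 0 and y = 1, where [alpha] is 1, [beta] is r + s - 1 and [crossing] is
   1. *)
Require Import Defs.
From mathcomp Require Import all_boot all_order all_algebra.
From mathcomp Require Import mpoly.
From mathcomp Require Import ring zify.

Set Implicit Arguments.
Unset Strict Implicit.
Unset Printing Implicit Defensive.

Import GRing.Theory.
Local Open Scope ring_scope.

(** * Partition functions with domain wall boundary conditions *)

(* The weight of a matrix entry is [w flip h u], where [flip] tells whether the
   entry is nonzero, and the bits [h] and [u] are the sums of the entries to its
   left in the same row and above it in the same column.  A nonzero entry flips
   both bits, which must be equal. *)
Definition weight (R : Type) := bool -> bool -> bool -> R.

Section StateSum.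
Variable R : comNzRingType.
Implicit Types (W : nat -> weight R) (us : seq bool) (h : bool).
Implicit Types f g : seq bool -> R.

(* Sum over the rows that start from the bit [h] and end with the bit [true], for
   the column bits [us] above the row; [f] is applied to the bits below it. *)
Fixpoint row_op W us h f : R :=
  if us is u :: us' then
    W 0 false h u * row_op (fun j => W j.+1) us' h (fun d => f (u :: d))
    + (if h == u then
         W 0 true h u
         * row_op (fun j => W j.+1) us' (~~ h) (fun d => f (~~ u :: d))
       else 0)
  else h%:R * f [::].

Fixpoint state_sum (m : nat) (V : nat -> nat -> weight R) us : R :=
  if m is m'.+1 then row_op (V 0) us false (state_sum m' (fun i => V i.+1))
  else (all id us)%:R.

Definition dwbc (n : nat) (V : nat -> nat -> weight R) : R :=
  state_sum n V (nseq n false).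

Lemma eq_row_op W W' us h f g :
    (forall j b k u, (j < size us)%N -> W j b k u = W' j b k u) ->
    (forall d, size d = size us -> f d = g d) ->
  row_op W us h f = row_op W' us h g.
Proof.
elim: us W W' h f g => [|u us IH] W W' h f g eW ef /=; first by rewrite ef.
rewrite !eW //; congr (_ * _ + _); last case: ifP => // _; try congr (_ * _).
  by apply: IH => [j b k v lt_j|d sz_d];
    [apply: eW | apply: ef; rewrite /= sz_d].
by apply: IH => [j b k v lt_j|d sz_d]; [apply: eW | apply: ef; rewrite /= sz_d].
Qed.

Lemma eq_row_opr W us h f g :
    (forall d, size d = size us -> f d = g d) ->
  row_op W us h f = row_op W us h g.
Proof. exact: eq_row_op. Qed.

Lemma eq_state_sum m (V V' : nat -> nat -> weight R) us :
    (forall i j b k u, (i < m)%N -> (j < size us)%N ->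
       V i j b k u = V' i j b k u) ->
  state_sum m V us = state_sum m V' us.
Proof.
elim: m V V' us => //= m IH V V' us eV; apply: eq_row_op => [j b k u lt_j|d sz_d].
  exact: eV.
by apply: IH => i j b k u lt_i; rewrite sz_d; apply: eV.
Qed.

Lemma row_op_lin W us h a b f g :
  row_op W us h (fun d => a * f d + b * g d)
  = a * row_op W us h f + b * row_op W us h g.
Proof.
elim: us W h f g => [|u us IH] W h f g /=; first by ring.
by rewrite !IH; case: ifP => _; ring.
Qed.

Lemma row_opZ W us h a f :
  row_op W us h (fun d => a * f d) = a * row_op W us h f.
Proof.
rewrite -[RHS]addr0 -(mul0r (row_op W us h f)) -row_op_lin.
by apply: eq_row_op => // d _; rewrite mul0r addr0.
Qed.

End StateSum.

Lemma row_op0 (R : comNzRingType) (W : nat -> weight R) us h :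
  row_op W us h (fun=> 0) = 0.
Proof. by have := row_opZ W us h 0 (fun=> 0); rewrite !mul0r. Qed.

Lemma row_op_morph (R S : comNzRingType) (phi : {rmorphism R -> S})
    (W : nat -> weight R) us h f :
  phi (row_op W us h f)
  = row_op (fun j b k u => phi (W j b k u)) us h (fun d => phi (f d)).
Proof.
elim: us W h f => [|u us IH] W h f /=; first by rewrite rmorphM rmorph_nat.
rewrite rmorphD rmorphM IH; case: ifP => _; last by rewrite rmorph0.
by rewrite rmorphM IH.
Qed.

Lemma state_sum_morph (R S : comNzRingType) (phi : {rmorphism R -> S}) m
    (V : nat -> nat -> weight R) us :
  phi (state_sum m V us)
  = state_sum m (fun i j b k u => phi (V i j b k u)) us.
Proof.
elim: m V us => [|m IH] V us /=; first by rewrite rmorph_nat.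
by rewrite row_op_morph; apply: eq_row_op.
Qed.

(* Only the product of the weights of 1 and -1 matters for the integrability, so
   the entries 1 are given weight 1; the factor [x] is likewise carried by the
   zeros with [h = u = true] only. *)
Definition six_weight (R : comNzRingType) (x a b c : R) : weight R :=
  fun flip h u =>
    if flip then (if h then c else 1)
    else if h == u then (if h then x * b else b) else a.

(** * Yang-Baxter equation and symmetry in the row parameters *)

Section Integrable.
Variable R : comNzRingType.
Variables x y : R.

(* These weights are normalized so that a row of parameter [r] has
   [beta / alpha = r] at [s = 1]; the model is homogeneous at [r = s = 1]. *)
Definition alpha (r s : R) : R := y - x * (r - 1) * (s - 1).
Definition beta (r s : R) : R := y * r * s - (r - 1) * (s - 1).
(** Let theta and theta' be the roots of X^2 - (1 + x - y) X + x. Then alpha - theta beta = (1 - r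
    theta)(1 - s theta)(1 - theta'), where 1 - theta has norm y, and [gamma r] is the norm of 1 - r
    theta. Taking norms, alpha^2 + x beta^2 - (1 + x - y) alpha beta = y gamma(r) gamma(s), the
    weight of the entries -1 below: the anisotropy invariant of the six-vertex model does not depend
    on r and s. *)
Definition gamma (r : R) : R := x * r ^+ 2 - (1 + x - y) * r + 1.
Definition sv_weight (r s : R) : weight R :=
  six_weight x (alpha r s) (beta r s) (y * gamma r * gamma s).

Definition sv_sum n (r s : nat -> R) : R :=
  dwbc n (fun i j => sv_weight (r i) (s j)).

(* The weight of the intertwiner of two rows on equal horizontal bits. *)
Definition crossing (r r' : R) : R := x * r * r' - (1 + x - y) * r' + 1.

Definition two_rows r r' (s : nat -> R) us h1 h2 f :=
  row_op (fun j => sv_weight r (s j)) us h1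
    (fun d => row_op (fun j => sv_weight r' (s j)) d h2 f).

Lemma row_opZ0 (W : nat -> weight R) us h a f :
  row_op W us h (fun d => a * f d + 0) = a * row_op W us h f.
Proof. by rewrite -row_opZ; apply: eq_row_op => // d _; rewrite addr0. Qed.

(** The intertwiner is carried through the rows column by column. At the right end both bits are
    [true] and it acts by the scalar [crossing]; the mixed bits are needed because they occur in the
    middle of the rows. The factor x in only one of the mixed equations reflects the asymmetric
    distribution of x and of the weights of 1 and -1. *)
Lemma yang_baxter r r' s us f :
  [/\ crossing r r' * two_rows r' r s us false false f
      = crossing r r' * two_rows r r' s us false false f,
      crossing r r' * two_rows r' r s us true true f
      = crossing r r' * two_rows r r' s us true true f,
      crossing r r' * two_rows r' r s us false true f
      = gamma r * two_rows r r' s us false true f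
        - x * (r' - r) * two_rows r r' s us true false f
    & crossing r r' * two_rows r' r s us true false f
      = gamma r' * two_rows r r' s us true false f
        - (r' - r) * two_rows r r' s us false true f].
Proof.
elim: us s f => [|u us IH] s f; first by rewrite /two_rows /=; split; ring.
have fold p p' b k1 k2 :
    row_op (fun j => sv_weight p (s j.+1)) us k1
      (fun d => row_op (fun j => sv_weight p' (s j.+1)) d k2
        (fun e => f (b :: e)))
    = two_rows p p' (fun j => s j.+1) us k1 k2 (fun e => f (b :: e)) by [].
have [] := IH (fun j => s j.+1) (fun d => f (false :: d)).
have [] := IH (fun j => s j.+1) (fun d => f (true :: d)).
rewrite /two_rows /=.
by case: u => /=; rewrite !(row_op_lin, row_opZ0) !fold;
  (* Two orders of the rows, four pairs of bits and two possible bits below the first column. *)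
  do 16! [move: (two_rows _ _ _ _ _ _ _) => ?]; move=> e1 e2 e3 e4 e5 e6 e7 e8;
  rewrite /sv_weight /six_weight /=;
  set k := crossing r r' in e1 e2 e3 e4 e5 e6 e7 e8 *;
  split; rewrite ?mulrDr ?mulr0 ?[k * (_ * _)]mulrCA;
  rewrite ?(e1, e2, e3, e4, e5, e6, e7, e8) /k /crossing /alpha /beta /gamma;
  ring.
Qed.

Lemma row_op_swap r r' s us f :
    GRing.lreg (crossing r r') ->
  two_rows r' r s us false false f = two_rows r r' s us false false f.
Proof. by have [e _ _ _] := yang_baxter r r' s us f; apply. Qed.

Definition sv_state m (r s : nat -> R) us : R :=
  state_sum m (fun i j => sv_weight (r i) (s j)) us.

Definition skip {A : Type} i (r : nat -> A) : nat -> A := fun k => r (bump i k).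
Definition scons {A : Type} a (r : nat -> A) : nat -> A :=
  fun k => if k is k'.+1 then r k' else a.

Lemma sv_state_front m i r s us :
    (i < m)%N ->
    (forall j k, (j < m)%N -> (k < m)%N -> j != k ->
       GRing.lreg (crossing (r j) (r k))) ->
  sv_state m r s us = sv_state m (scons (r i) (skip i r)) s us.
Proof.
elim: i m r us => [|i IH] [//|m] r us lt_im reg_r.
  by apply: eq_state_sum => -[|k].
case: m lt_im reg_r => // m lt_im reg_r.
have {}IH d : sv_state m.+1 (fun k => r k.+1) s d
    = sv_state m.+1 (scons (r i.+1) (skip i (fun k => r k.+1))) s d.
  by apply: IH => // j k lt_j lt_k ne_jk; apply: reg_r.
rewrite /sv_state /= in IH *.
rewrite (eq_row_opr _ _ (fun d _ => IH d)).
rewrite -[LHS]row_op_swap; last exact: reg_r.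
apply: eq_row_op => // d _; apply: eq_row_op => // d' _.
by apply: eq_state_sum => k j b h u _ _; rewrite /skip /bump /= ltnS addnS.
Qed.

Lemma sv_sum_front n i r s :
    (i < n)%N ->
    (forall j k, (j < n)%N -> (k < n)%N -> j != k ->
       GRing.lreg (crossing (r j) (r k))) ->
  sv_sum n r s = sv_sum n (scons (r i) (skip i r)) s.
Proof. exact: sv_state_front. Qed.

End Integrable.

(** * Frozen lines and dependence on the corner weights *)

Section Freezing.
Variable R : comNzRingType.
Implicit Types (W : nat -> weight R) (V : nat -> nat -> weight R).

(** A nonzero entry needs equal bits, so the horizontal bit [true] never flips below column bits
    that are all [false]. *)
Lemma row_op_true_false W n f :
  row_op W (nseq n false) true f
  = (\prod_(j < n) W j false true false) * f (nseq n false).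
Proof.
elim: n W f => [|n IH] W f /=; first by rewrite big_ord0.
by rewrite addr0 IH big_ord_recl mulrA.
Qed.

(** An entry -1 would leave the bit [false] below it, and an entry 1 cannot occur before it. *)
Lemma row_op_true_all W us :
  row_op W us true (fun d => (all id d)%:R)
  = (\prod_(j < size us) W j false true true) * (all id us)%:R.
Proof.
elim: us W => [|u us IH] W /=; first by rewrite big_ord0.
by case: u; rewrite /= row_op0 mulr0 ?addr0 ?mulr0 // IH big_ord_recl mulrA.
Qed.

(** Every row starts from [false], so a bit [true] at the top of the first column never flips. *)
Lemma state_sum_true m V us :
  state_sum m V (true :: us)
  = (\prod_(i < m) V i 0 false false true)
    * state_sum m (fun i j => V i j.+1) us.
Proof.
elim: m V us => [|m IH] V us /=; first by rewrite big_ord0 mul1r.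
rewrite addr0 big_ord_recl -mulrA; congr (_ * _).
by rewrite -row_opZ; apply: eq_row_opr => d _; rewrite IH.
Qed.

Lemma state_sum_true_row m V n :
  row_op (fun j => V 0 j.+1) (nseq n false) true
    (fun d => state_sum m (fun i => V i.+1) (true :: d))
  = (\prod_(j < n) V 0 j.+1 false true false)
    * (\prod_(i < m) V i.+1 0 false false true)
    * state_sum m (fun i j => V i.+1 j.+1) (nseq n false).
Proof. by rewrite row_op_true_false state_sum_true mulrA. Qed.

Lemma dwbc_freeze n V :
    V 0 0 false false false = 0 ->
  dwbc n.+1 V
  = V 0 0 true false false
    * ((\prod_(j < n) V 0 j.+1 false true false)
       * (\prod_(i < n) V i.+1 0 false false true)
       * dwbc n (fun i j => V i.+1 j.+1)).
Proof. by move=> V0; rewrite /dwbc /= V0 mul0r add0r state_sum_true_row. Qed.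

(** Either the lower left entry is 0 below a bit [true], and the corner contributes the first
    factor, or it is 1, which freezes the first column above it and the last row. [U] is chosen
    before V', so models that differ only in this corner weight share it. *)
Lemma state_sum_low_corner m V :
  exists U : seq bool -> R, forall V' us,
      (forall i j, (i != m) || (j != 0%N) -> V' i j = V i j) ->
      V' m 0 true false false = V m 0 true false false ->
    state_sum m.+1 V' (false :: us)
    = V' m 0 false false true * U us
      + V m 0 true false false
        * (\prod_(i < m) V i 0 false false false)
        * (\prod_(j < size us) V m j.+1 false true true)
        * state_sum m (fun i j => V i j.+1) us.
Proof.
elim: m V => [|m IH] V.
  exists (fun=> 0) => V' us eV e0.
  rewrite /= big_ord0 mulr0 add0r mulr1 e0 row_op0 mulr0 add0r row_op_true_all.
  by rewrite mulrA; congr (_ * _ * _); apply: eq_bigr => j _; rewrite eV.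
have [U eU] := IH (fun i => V i.+1).
exists (fun us =>
  V 0 0 false false false * row_op (fun j => V 0 j.+1) us false U
  + V 0 0 true false false
    * row_op (fun j => V 0 j.+1) us true
        (fun d => (\prod_(i < m) V i.+1 0 false false true)
                  * state_sum m.+1 (fun i j => V i.+1 j.+1) d)).
move=> V' us eV e0.
have eVS i j : (i != m) || (j != 0%N) -> V' i.+1 j = V i.+1 j.
  by move=> ij; apply: eV; rewrite eqSS.
set q := V' m.+1 0 false false true.
have e1 d : state_sum m.+1 (fun i => V' i.+1) (true :: d)
    = q * ((\prod_(i < m) V i.+1 0 false false true)
           * state_sum m.+1 (fun i j => V i.+1 j.+1) d).
  rewrite state_sum_true big_ord_recr [X in X * _]mulrC -mulrA; congr (_ * (_ * _)).
    by apply: eq_bigr => i _; rewrite eVS ?(ltn_eqF (ltn_ord i)).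
  by apply: eq_state_sum => i j b h u _ _; rewrite eVS ?orbT.
transitivity
  (V 0 0 false false false * row_op (fun j => V 0 j.+1) us false (fun d =>
     state_sum m.+1 (fun i => V' i.+1) (false :: d))
   + V 0 0 true false false * row_op (fun j => V 0 j.+1) us true (fun d =>
     state_sum m.+1 (fun i => V' i.+1) (true :: d))).
  rewrite /= eV //; congr (_ * _ + _ * _);
    by apply: eq_row_op => // j b h u _; rewrite eV.
rewrite (eq_row_opr _ _ (fun d _ => e1 d)) row_opZ.
pose C := V m.+1 0 true false false * (\prod_(i < m) V i.+1 0 false false false)
          * (\prod_(j < size us) V m.+1 j.+1 false true true).
rewrite (@eq_row_opr _ _ us false _
  (fun d => q * U d + C * state_sum m (fun i j => V i.+1 j.+1) d)); last first.
  by move=> d sz_d; rewrite eU // sz_d.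
have -> : \prod_(i < m.+1) V i 0 false false false
    = V 0 0 false false false * \prod_(i < m) V i.+1 0 false false false.
  by rewrite big_ord_recl.
rewrite row_op_lin /C [state_sum m.+1 (fun i j => V i j.+1) us]/=; ring.
Qed.

(* As a function of its weights at the two left corners, the partition function
   is affine in the two weights that the corners can take besides the entry 1. *)
Lemma dwbc_corners n V :
  exists U : R, forall V',
      (forall i j, (i \notin [:: 0%N; n.+1]) || (j != 0%N) -> V' i j = V i j) ->
      (forall i, V' i 0 true false false = V i 0 true false false) ->
    let p := V' 0 0 false false false in
    let q := V' n.+1 0 false false true in
    dwbc n.+2 V'
    = p * q * U
      + q * (V 0 0 true false false
             * (\prod_(j < n.+1) V 0 j.+1 false true false)
             * (\prod_(i < n) V i.+1 0 false false true)
             * dwbc n.+1 (fun i j => V i.+1 j.+1))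
      + p * (V n.+1 0 true false false
             * (\prod_(i < n) V i.+1 0 false false false)
             * (\prod_(j < n.+1) V n.+1 j.+1 false true true)
             * dwbc n.+1 (fun i j => V i j.+1)).
Proof.
have [U eU] := state_sum_low_corner n (fun i => V i.+1).
exists (row_op (fun j => V 0 j.+1) (nseq n.+1 false) false U) => V' eV e0 p q.
have eV0 j : V' 0 j.+1 = V 0 j.+1 by rewrite eV ?orbT.
have eVS i j : (i != n) || (j != 0%N) -> V' i.+1 j = V i.+1 j.
  by move=> ij; rewrite eV // !inE.
have eR h f : row_op (fun j => V' 0 j.+1) (nseq n.+1 false) h f
    = row_op (fun j => V 0 j.+1) (nseq n.+1 false) h f.
  by apply: eq_row_op => // j b h' u _; rewrite eV0.
transitivity
  (p * row_op (fun j => V 0 j.+1) (nseq n.+1 false) false (fun d =>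
     state_sum n.+1 (fun i => V' i.+1) (false :: d))
   + V 0 0 true false false * row_op (fun j => V 0 j.+1) (nseq n.+1 false) true
       (fun d => state_sum n.+1 (fun i => V' i.+1) (true :: d))).
  rewrite -e0 -!eR; reflexivity.
pose C := V n.+1 0 true false false * (\prod_(i < n) V i.+1 0 false false false)
          * (\prod_(j < n.+1) V n.+1 j.+1 false true true).
rewrite (@eq_row_opr _ _ (nseq n.+1 false) false _
  (fun d => q * U d + C * state_sum n (fun i j => V i.+1 j.+1) d)); last first.
  by move=> d; rewrite size_nseq => sz_d; rewrite eU // sz_d.
rewrite row_op_lin row_op_true_false state_sum_true.
have -> : \prod_(i < n.+1) V' i.+1 0 false false true
    = (\prod_(i < n) V i.+1 0 false false true) * q.
  rewrite big_ord_recr; congr (_ * _); apply: eq_bigr => i _.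
  by rewrite eVS ?(ltn_eqF (ltn_ord i)).
have -> : state_sum n.+1 (fun i j => V' i.+1 j.+1) (nseq n.+1 false)
    = dwbc n.+1 (fun i j => V i.+1 j.+1).
  by apply: eq_state_sum => i j b h u _ _; rewrite eVS ?orbT.
have -> : row_op (fun j => V 0 j.+1) (nseq n.+1 false) false
            (fun d => state_sum n (fun i j => V i.+1 j.+1) d)
    = dwbc n.+1 (fun i j => V i j.+1) by [].
rewrite /C; ring.
Qed.

End Freezing.

(** * The Izergin-Korepin determinant *)

Section Degree.
Variable K : idomainType.

Lemma size_row_op (W : nat -> weight {poly K}) us h (f : seq bool -> {poly K}) k :
    (forall j b h u, (size (W j b h u) <= 1)%N) ->
    (forall d, (size (f d) <= k)%N) ->
  (size (row_op W us h f) <= k)%N.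
Proof.
elim: us W h f => [|u us IH] W h f szW szf /=.
  by rewrite mulr_natl -scaler_nat (leq_trans (size_scale_leq _ _)).
have szM (p q : {poly K}) : (size p <= 1)%N -> (size q <= k)%N -> (size (p * q)%R <= k)%N.
  by move=> p1 qk; rewrite (leq_trans (size_polyMleq _ _)) //; lia.
rewrite (leq_trans (size_polyD _ _)) // geq_max szM ?IH //=.
by case: ifP => _; rewrite ?size_poly0 // szM ?IH.
Qed.

(** Only the first column involves the indeterminate, and it holds no -1 since every row starts from
    [false]. If its top bit is [false] it must contain a 1, of constant weight, which lowers the
    degree by one. Charging the whole weight [c] to the entries -1 is what makes that weight
    constant. *)
Lemma size_state_sum m (V : nat -> nat -> weight {poly K}) b us :
    (forall i h u, (size (V i 0 false h u) <= 2)%N) ->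
    (forall i, (size (V i 0 true false false) <= 1)%N) ->
    (forall i j b h u, (size (V i j.+1 b h u) <= 1)%N) ->
  (size (state_sum m V (b :: us)) <= m + b)%N.
Proof.
elim: m V b us => [|m IH] V b us sz0 sz1 szS.
  by case: b; rewrite /= ?size_poly0 //; case: all; rewrite ?size_poly0 ?size_poly1.
have szM (p q : {poly K}) k l :
    (size p <= k)%N -> (size q <= l)%N -> (size (p * q)%R <= (k + l).-1)%N.
  by move=> pk ql; rewrite (leq_trans (size_polyMleq _ _)) //; lia.
have sz_tail h b' : (size (row_op (fun j => V 0 j.+1) us h
    (fun d => state_sum m (fun i => V i.+1) (b' :: d))) <= m + b')%N.
  by apply: size_row_op => // d; apply: IH.
case: b => /=; rewrite ?addr0.
  by rewrite (leq_trans (szM _ _ _ _ (sz0 _ _ _) (sz_tail _ _))) //; lia.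
rewrite (leq_trans (size_polyD _ _)) // geq_max.
rewrite (leq_trans (szM _ _ _ _ (sz0 _ _ _) (sz_tail _ _))) /=; last by lia.
by rewrite (leq_trans (szM _ _ _ _ (sz1 _) (sz_tail _ _))) //; lia.
Qed.

Lemma sv_sum_poly (x y : K) n r s :
  exists2 p : {poly K}, (size p <= n.+1)%N
    & forall t, p.[t] = sv_sum x y n.+1 r (scons t s).
Proof.
pose sX := scons 'X (fun j => (s j)%:P).
exists (sv_sum x%:P y%:P n.+1 (fun i => (r i)%:P) sX).
  rewrite -[X in (_ <= X)%N]addn0; apply: size_state_sum => [i h u|i|i j b h u] /=.
  - rewrite /sv_weight /six_weight /alpha /beta.
    have sz_lin (a b : K) : (size (a%:P * 'X + b%:P)%R <= 2)%N.
      by rewrite size_MXaddC; case: ifP => // _; rewrite ltnS size_polyC_leq1.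
    case: ifP => _; first case: h.
    + rewrite [X in polyseq X](_ : _ =
        (x * (y * r i - (r i - 1)))%:P * 'X + (x * (r i - 1))%:P) //.
      rewrite !(rmorphM, rmorphB, rmorph1) /=; ring.
    + rewrite [X in polyseq X](_ : _ =
        (y * r i - (r i - 1))%:P * 'X + (r i - 1)%:P) //.
      rewrite !(rmorphM, rmorphB, rmorph1) /=; ring.
    rewrite [X in polyseq X](_ : _ =
      (- x * (r i - 1))%:P * 'X + (y + x * (r i - 1))%:P) //.
    rewrite !(rmorphM, rmorphB, rmorphN, rmorphD, rmorph1) /=; ring.
  - by rewrite size_poly1.
  rewrite [X in polyseq X](_ : _ = (sv_weight x y (r i) (s j) b h u)%:P);
    first exact: size_polyC_leq1.
  rewrite /sv_weight /six_weight /alpha /beta /gamma.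
  by case: b; case: h; case: u => /=;
    rewrite !(rmorphM, rmorphB, rmorphN, rmorphD, rmorphXn, rmorph1).
move=> t; rewrite -/(horner_eval t _) [LHS](state_sum_morph (horner_eval t)).
apply: eq_state_sum => i j b h u _ _; rewrite /sv_weight /six_weight /alpha /beta /gamma.
by case: j => [|j]; case: b; case: h; case: u; rewrite /= /horner_eval !hornerE.
Qed.
End Degree.

Fixpoint difference_prod (R : comNzRingType) n (r : nat -> R) : R :=
  if n is n'.+1 then
    (\prod_(j < n') (r 0 - r j.+1)) * difference_prod n' (fun k => r k.+1)
  else 1.

Lemma eq_difference_prod (R : comNzRingType) n (r r' : nat -> R) :
  (forall k, r k = r' k) -> difference_prod n r = difference_prod n r'.
Proof.
elim: n r r' => //= n IH r r' e; congr (_ * _); last exact: IH.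
by apply: eq_bigr => j _; rewrite !e.
Qed.

Lemma difference_prod_skip (R : comNzRingType) n i (r : nat -> R) :
    (i < n.+1)%N ->
  difference_prod n.+1 r
  = (-1) ^+ i * (\prod_(k < n) (r i - r (bump i k)))
    * difference_prod n (skip i r).
Proof.
elim: i n r => [|i IH] n r lt_in; first by rewrite expr0 mul1r.
case: n lt_in => // n lt_in.
rewrite [LHS]/= -/(difference_prod n.+1 (fun k => r k.+1)) IH //.
rewrite (bigD1_ord (Ordinal (lt_in : (i < n.+1)%N))) //= big_ord_recl /=.
rewrite (_ : \prod_(k < n) (r i.+1 - r (bump i.+1 (bump 0 k)))
  = \prod_(k < n) (r i.+1 - r (bump i k).+1)); last first.
  by apply: eq_bigr => k _; rewrite /bump /= ltnS add1n addnS.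
rewrite (_ : \prod_(k < n) (skip i.+1 r 0 - skip i.+1 r k.+1)
  = \prod_(k < n) (r 0 - r (bump i k).+1)); last first.
  by apply: eq_bigr => k _; rewrite /skip /bump /= ltnS addnS.
rewrite (@eq_difference_prod _ _ (fun k => skip i.+1 r k.+1)
  (skip i (fun k => r k.+1))); last first.
  by move=> k; rewrite /skip /bump ltnS addnS.
rewrite [bump i.+1 0]/bump /= exprS; ring.
Qed.

Section Generic.
Variables (R : idomainType) (x y : R).

Definition vertex (r s : R) : R := alpha x y r s * beta y r s.

(** [gen_vertex] gives sense to the inverses in the determinant, [gen_pole] lets [beta] have a root
    in the column parameter, [gen_row] and [gen_col] separate the interpolation points, and
    [gen_crossing] allows the exchange of rows. *)
Record generic n (r s : nat -> R) : Prop := Generic {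
  gen_vertex : forall i j, (i < n)%N -> (j < n)%N -> vertex (r i) (s j) != 0;
  gen_pole : forall i, (i < n)%N -> 1 + (y - 1) * r i != 0;
  gen_row : forall i j, (i < n)%N -> (j < n)%N -> i != j -> r i != r j;
  gen_col : forall i j, (i < n)%N -> (j < n)%N -> i != j -> s i != s j;
  gen_crossing : forall i j, (i < n)%N -> (j < n)%N -> i != j ->
    crossing x y (r i) (r j) != 0
}.

Lemma bump_ltn n i k : (i < n.+1)%N -> (k < n)%N -> (bump i k < n.+1)%N.
Proof. by rewrite /bump; lia. Qed.

Lemma generic_skip n r s i j :
  (i < n.+1)%N -> (j < n.+1)%N -> generic n.+1 r s ->
  generic n (skip i r) (skip j s).
Proof.
move=> lt_i lt_j [gv gp gr gc gx].
split=> [k l|k|k l|k l|k l] *; rewrite /skip;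
  [apply: gv|apply: gp|apply: gr|apply: gc|apply: gx];
  by rewrite ?bump_ltn ?(inj_eq (can_inj (bumpK _))).
Qed.

End Generic.

Section Izergin.
Variables (K : fieldType) (x y : K).
Local Notation vertex := (vertex x y).
Local Notation generic := (generic x y).

Definition izergin_mx n (r s : nat -> K) : 'M[K]_n :=
  \matrix_(i, j) (vertex (r i) (s j))^-1.

(** [beta] is a bilinear form in (1, r) and (1, s) of determinant -y; this is its 2 by 2 minor on r,
    r' and s, s', one of whose two products vanishes. *)
Lemma beta_exchange r r' s s' :
  beta y r s = 0 -> beta y r' s * beta y r s' = y * (r - r') * (s - s').
Proof.
move=> b0; rewrite -[LHS]subr0 -(mul0r (beta y r' s')) -b0 /beta; ring.
Qed.

Definition vertexp r : {poly K} :=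
  ((- x * (r - 1))%:P * 'X + (y + x * (r - 1))%:P)
  * ((y * r - (r - 1))%:P * 'X + (r - 1)%:P).

Lemma size_vertexp r : (size (vertexp r) <= 3)%N.
Proof.
have sz_lin (a b : K) : (size (a%:P * 'X + b%:P)%R <= 2)%N.
  by rewrite size_MXaddC; case: ifP => // _; rewrite ltnS size_polyC_leq1.
rewrite (leq_trans (size_polyMleq _ _)) // -subn1 leq_subLR.
exact: leq_add (sz_lin _ _) (sz_lin _ _).
Qed.

Lemma horner_vertexp r t : (vertexp r).[t] = vertex r t.
Proof. rewrite /vertexp /vertex /alpha /beta !hornerE /=; ring. Qed.

Lemma izergin_column n r s :
  \det (izergin_mx n.+1 r s)
  = \sum_(i < n.+1) (vertex (r i) (s 0))^-1
      * ((-1) ^+ i * \det (izergin_mx n (skip i r) (skip 0 s))).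
Proof.
rewrite (expand_det_col _ ord0); apply: eq_bigr => i _.
rewrite mxE /cofactor addn0; congr (_ * (_ * \det _)).
by apply/matrixP => k l; rewrite !mxE.
Qed.

Lemma izergin_mx_eq_col n r s j :
  (j < n)%N -> \det (izergin_mx n.+1 r (scons (s j) s)) = 0.
Proof.
move=> lt_jn; rewrite -det_tr.
apply: (@determinant_alternate _ _ _ ord0 (lift ord0 (Ordinal lt_jn))) => // k.
by rewrite !mxE.
Qed.

(* Both sides are polynomials of degree at most 2n in the parameter of the first
   of n+1 columns; they agree when it equals that of another column, where both
   vanish, and when it cancels the weight [beta] of the top left corner for some
   choice of the first row, where both reduce to size n. *)
Theorem izergin_det n r s :
  y != 0 -> generic n r s ->
  \det (izergin_mx n r s) * \prod_(i < n) \prod_(j < n) vertex (r i) (s j)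
  = y ^+ 'C(n, 2) * difference_prod n r * difference_prod n s
    * sv_sum x y n r s.
Proof.
move=> y0; elim: n r s => [|n IH] r s gen.
  by rewrite det_mx00 big_ord0 /= !mulr1.
pose s' k := s k.+1.
pose c i : K := (-1) ^+ i * \det (izergin_mx n (skip i r) s').
pose E := \prod_(i < n.+1) \prod_(j < n) vertex (r i) (s' j).
(* In the expansion along the first column, multiplying by [vertex] over all the rows leaves in the
   i-th term the product over the other rows. *)
pose cofp i : {poly K} := \prod_(k < n) vertexp (skip i r k).
have sz_cofp i : (size (cofp i) <= n.*2.+1)%N.
  rewrite (leq_trans (size_prod_leq _ _)) // card_ord.
  have -> : n.*2.+1 = ((\sum_(k < n) 3).+1 - n)%N.
    by rewrite sum_nat_const card_ord -addnn; lia.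
  by rewrite leq_sub2r // ltnS leq_sum // => k _; apply: size_vertexp.
have cofpE (i : 'I_n.+1) t : vertex (r i) t != 0 ->
    (cofp i).[t] = (\prod_(k < n.+1) vertex (r k) t) * (vertex (r i) t)^-1.
  move=> v0; rewrite (bigD1_ord i) //= mulrAC mulfV // mul1r horner_prod.
  by apply: eq_bigr => k _; rewrite horner_vertexp.
pose p2 : {poly K} := \sum_(i < n.+1) (c i * E) *: cofp i.
have p2S t : p2.[t] = \sum_(i < n.+1) c i * E * (cofp i).[t].
  by rewrite horner_sum; apply: eq_bigr => i _; rewrite hornerZ.
have p2E t : (forall i : 'I_n.+1, vertex (r i) t != 0) ->
    p2.[t] = E * (\prod_(k < n.+1) vertex (r k) t)
             * \det (izergin_mx n.+1 r (scons t s')).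
  move=> v0; rewrite izergin_column mulr_sumr p2S.
  apply: eq_bigr => i _; rewrite cofpE //= -/(c i); ring.
have [p sz_p pE] := sv_sum_poly x y n r s'.
(* The Vandermonde product of all the columns is that of [s'] times the factors t - s' j, which go
   into [p1]. *)
pose C := y ^+ 'C(n.+1, 2) * difference_prod n.+1 r * difference_prod n s'.
pose p1 : {poly K} := C *: ((\prod_(j < n) ('X - (s' j)%:P)) * p).
have p1E t : p1.[t] = C * (\prod_(j < n) (t - s' j)) * sv_sum x y n.+1 r (scons t s').
  rewrite hornerZ hornerM pE horner_prod mulrA; congr (_ * _ * _).
  by apply: eq_bigr => j _; rewrite hornerXsubC.
suff e12 : p1 = p2.
  have := p1E (s 0); rewrite e12 p2E; last first.
    by move=> i; apply: (gen_vertex gen).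
  have e0 k : scons (s 0) s' k = s k by case: k.
  have -> : izergin_mx n.+1 r (scons (s 0) s') = izergin_mx n.+1 r s.
    by apply/matrixP => i j; rewrite !mxE e0.
  have -> : sv_sum x y n.+1 r (scons (s 0) s') = sv_sum x y n.+1 r s.
    by apply: eq_state_sum => i j b h u _ _; rewrite e0.
  have -> : \prod_(i < n.+1) \prod_(j < n.+1) vertex (r i) (s j)
      = (\prod_(i < n.+1) vertex (r i) (s 0)) * E.
    by rewrite -big_split /=; apply: eq_bigr => i _; rewrite big_ord_recl.
  by move=> e; rewrite mulrC [X in X * _]mulrC e /C /=; ring.
apply/eqP; rewrite -subr_eq0; apply: contraT => p12.
pose sigma i : K := (1 - r i) / (1 + (y - 1) * r i).
have sigma0 i : (i < n.+1)%N -> beta y (r i) (sigma i) = 0.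
  move=> lt_i; have p0 := gen_pole gen lt_i.
  by rewrite /beta /sigma; field.
have sigma_neq i (i' : nat) : (i < n.+1)%N -> (i' < n.+1)%N -> i != i' ->
    beta y (r i') (sigma i) != 0.
  move=> lt_i lt_i' ne; apply/eqP => b0; have b1 := sigma0 _ lt_i.
  (* [beta y r s] is affine in r, with slope 1 + (y - 1) s and constant term s - 1. Two distinct
     zeros would cancel both, so that s = 1 and y = 0. *)
  have /eqP : (r i - r i') * (1 + (y - 1) * sigma i) = 0.
    by rewrite -[RHS]subr0 -{1}b1 -b0 /beta; ring.
  rewrite mulf_eq0 subr_eq0 (negPf (gen_row gen lt_i lt_i' ne)) /= => /eqP d0.
  have s1 : sigma i = 1.
    apply/eqP; rewrite -subr_eq0 -b1 /beta; apply/eqP.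
    by rewrite -[RHS]subr0 -(mulr0 (r i)) -d0; ring.
  by move/eqP: d0; rewrite s1 mulr1 addrC subrK (negPf y0).
have sv_sum_sigma i : (i < n.+1)%N ->
    sv_sum x y n.+1 r (scons (sigma i) s')
    = (\prod_(j < n) alpha x y (r i) (s' j))
      * (\prod_(k < n) alpha x y (skip i r k) (sigma i))
      * sv_sum x y n (skip i r) s'.
  move=> lt_i.
  (* Once row i is on top, the weight of a zero in the corner is [beta y (r i) (sigma i)] = 0, and
     [dwbc_freeze] applies. *)
  transitivity (sv_sum x y n.+1 (scons (r i) (skip i r)) (scons (sigma i) s')).
    apply: sv_sum_front => // j k lt_j lt_k ne.
    exact/mulfI/(gen_crossing gen).
  rewrite {1}/sv_sum dwbc_freeze; last exact: sigma0.
  by rewrite mul1r.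
pose rs := [seq sigma (val i) | i <- enum 'I_n.+1] ++ [seq s' (val j) | j <- enum 'I_n].
have uniq_rs : uniq rs.
  rewrite cat_uniq; apply/and3P; split.
  - rewrite map_inj_in_uniq ?enum_uniq // => j k _ _ e; apply/val_inj/eqP.
    apply: contraTT isT => ne.
    by have := sigma_neq _ _ (ltn_ord j) (ltn_ord k) ne; rewrite e sigma0 ?eqxx.
  - apply/hasPn => _ /mapP[j _ ->]; apply/mapP => -[i _ e].
    have := gen_vertex gen (ltn_ord i) (ltn_ord (lift ord0 j)).
    by rewrite /vertex mulf_eq0 negb_or -/(s' j) e sigma0 // eqxx andbF.
  rewrite map_inj_in_uniq ?enum_uniq // => j k _ _ e; apply/val_inj/eqP.
  apply: contraTT isT => ne.
  have := gen_col gen (ltn_ord (lift ord0 j)) (ltn_ord (lift ord0 k)).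
  by rewrite -/(s' j) -/(s' k) e eqxx => /(_ ne).
have root_rs : all (root (p1 - p2)) rs.
  have root12 t : p1.[t] = p2.[t] -> root (p1 - p2) t.
    by move=> e; rewrite rootE hornerD hornerN e subrr.
  apply/allP => t; rewrite mem_cat => /orP[] /mapP[i _ ->]; apply: root12;
    rewrite p1E; last first.
    rewrite (bigD1 i) //= subrr mul0r mulr0 mul0r p2E.
      by rewrite (izergin_mx_eq_col r s' (ltn_ord i)) mulr0.
    by move=> k; apply: (gen_vertex gen) (ltn_ord k) (ltn_ord (lift ord0 i)).
  rewrite (sv_sum_sigma _ (ltn_ord i)) p2S (bigD1 i) //=.
  (* Every other term contains [vertex] of row i at [sigma i], which is zero. *)
  rewrite [X in _ = _ + X]big1 => [|l ne_li]; last first.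
    have [k def_i _] := unlift_some ne_li.
    rewrite /cofp horner_prod (bigD1 k) //= horner_vertexp.
    rewrite /vertex /skip -[bump l k]/(val (lift l k)) -def_i sigma0 ?ltn_ord //.
    by rewrite mulr0 mul0r mulr0.
  rewrite addr0 /cofp horner_prod.
  have -> : E = (\prod_(j < n) vertex (r i) (s' j))
      * (\prod_(k < n) \prod_(j < n) vertex (skip i r k) (s' j)).
    by rewrite /E (bigD1_ord i).
  have e : \det (izergin_mx n (skip i r) s')
      * (\prod_(k < n) \prod_(j < n) vertex (skip i r k) (s' j))
    = y ^+ 'C(n, 2) * difference_prod n (skip i r) * difference_prod n s'
      * sv_sum x y n (skip i r) s'.
    exact: IH _ _ (generic_skip (ltn_ord i) (ltn0Sn n) gen).
  (* The sign of the cofactor equals that of extracting r i from the Vandermonde product, and the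
     exponent of y grows by n: one factor for each use of [beta_exchange]. *)
  rewrite /C binS bin1 exprD (difference_prod_skip _ (ltn_ord i)) /c.
  rewrite (eq_bigr _ (fun k _ => horner_vertexp _ _)).
  have e' : (\prod_(k < n) beta y (skip i r k) (sigma i)) * \prod_(j < n) beta y (r i) (s' j)
    = y ^+ n * (\prod_(k < n) (r i - r (bump i k))) * \prod_(j < n) (sigma i - s' j).
    have -> : y ^+ n = \prod_(k < n) y by rewrite prodr_const card_ord.
    rewrite -!big_split /=.
    by apply: eq_bigr => k _; apply/beta_exchange/sigma0.
  transitivity ((-1) ^+ i * (\prod_(j < n) alpha x y (r i) (s' j))
    * (\prod_(k < n) alpha x y (skip i r k) (sigma i))
    * (y ^+ 'C(n, 2) * difference_prod n (skip i r) * difference_prod n s'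
       * sv_sum x y n (skip i r) s')
    * (y ^+ n * (\prod_(k < n) (r i - r (bump i k)))
       * \prod_(j < n) (sigma i - s' j))); first by ring.
  rewrite -e -e' [X in _ = _ * (X * _) * _]big_split [X in _ = _ * X]big_split /=.
  ring.
have sz_p12 : (size (p1 - p2)%R <= n.*2.+1)%N.
  rewrite (leq_trans (size_polyD _ _)) // geq_max size_polyN; apply/andP; split.
    rewrite (leq_trans (size_scale_leq _ _)) // (leq_trans (size_polyMleq _ _)) //.
    rewrite size_prod_XsubC [index_enum _]unlock -enumT size_enum_ord.
    by rewrite -addnn -addnS addSn /= leq_add2l.
  rewrite (leq_trans (size_sum _ _ _)) //; apply/bigmax_leqP => i _.
  by rewrite (leq_trans (size_scale_leq _ _)).
have := max_poly_roots p12 root_rs uniq_rs.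
by rewrite ltnNge size_cat !size_map -!enumT !size_enum_ord addSn addnn sz_p12.
Qed.
End Izergin.

(** * The bilinear relation *)

Definition fun_mx (R : Type) n (F : nat -> nat -> R) : 'M[R]_n :=
  \matrix_(i, j) F i j.

(** The Schur complement cleared of denominators: the lower left block is eliminated with [\adj D]
    in place of the inverse of D. *)
Lemma det_block_adj (R : comNzRingType) m n (A : 'M[R]_m) B C (D : 'M_n) :
  \det (block_mx A B C D) * \det D ^+ m
  = \det (\det D *: A - B *m \adj D *m C) * \det D.
Proof.
have := det_mulmx (block_mx A B C D)
  (block_mx (\det D)%:M 0 (- (\adj D *m C)) 1%:M).
rewrite det_lblock det1 mulr1 det_scalar => <-.
rewrite mulmx_block !mulmx0 !mulmx1 !add0r !mulmxN !mul_mx_scalar mulmxA.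
rewrite [D *m _]mulmxA mul_mx_adj mul_scalar_mx subrr det_ublock.
by [].
Qed.

Section Jacobi.
Variables (R : idomainType).

Definition schur (n : nat) (F : nat -> nat -> R) : nat -> nat -> R :=
  let D := fun_mx n (fun k l => F k.+2 l.+2) in
  fun i j => \det D * F i j
    - \sum_(l < n) (\sum_(k < n) F i k.+2 * \adj D k l) * F l.+2 j.

Lemma det_skip_schur n F a b :
    \det (fun_mx n (fun k l => F k.+2 l.+2)) != 0 -> (a < 2)%N -> (b < 2)%N ->
  \det (fun_mx n.+1 (fun i j => F (bump a i) (bump b j)))
  = schur n F (1 - a) (1 - b).
Proof.
move=> D0 a2 b2; apply: (mulIf D0).
pose F' i j := F (bump a i) (bump b j).
have bumpa k : bump a k.+1 = k.+2 by rewrite /bump; lia.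
have bumpb k : bump b k.+1 = k.+2 by rewrite /bump; lia.
pose A : 'M[R]_1 := \matrix_(i, j) F' i j.
pose B : 'M[R]_(1, n) := \matrix_(i, j) F' i j.+1.
pose C : 'M[R]_(n, 1) := \matrix_(i, j) F' i.+1 j.
pose D := fun_mx n (fun k l => F k.+2 l.+2).
have -> : fun_mx n.+1 F' = block_mx A B C D.
  rewrite -[LHS](@submxK _ 1 n 1 n).
  apply: (f_equal4 (@block_mx R 1 n 1 n)); apply/matrixP => i j;
  by rewrite !mxE ?lshift0 /= /F' ?bumpa ?bumpb.
have := det_block_adj A B C D; rewrite expr1 => ->; congr (_ * _).
rewrite det_mx11 !mxE /schur /F' -/D.
have ea : bump a 0 = (1 - a)%N by rewrite /bump; lia.
have eb : bump b 0 = (1 - b)%N by rewrite /bump; lia.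
rewrite /= ea eb; congr (_ - _); apply: eq_bigr => l _.
rewrite !mxE /F' bumpa /= eb; congr (_ * _).
by apply: eq_bigr => k _; rewrite !mxE /F' bumpb /= ea.
Qed.

Lemma det_schur n F :
    \det (fun_mx n (fun k l => F k.+2 l.+2)) != 0 ->
  \det (fun_mx n.+2 F) * \det (fun_mx n (fun k l => F k.+2 l.+2))
  = schur n F 0 0 * schur n F 1 1 - schur n F 0 1 * schur n F 1 0.
Proof.
move=> D0; apply: (mulIf D0).
pose A : 'M[R]_2 := \matrix_(i, j) F i j.
pose B : 'M[R]_(2, n) := \matrix_(i, j) F i j.+2.
pose C : 'M[R]_(n, 2) := \matrix_(i, j) F i.+2 j.
pose D := fun_mx n (fun k l => F k.+2 l.+2).
have -> : fun_mx n.+2 F = block_mx A B C D.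
  rewrite -[LHS](@submxK _ 2 n 2 n).
  apply: (f_equal4 (@block_mx R 2 n 2 n)); apply/matrixP => i j;
  by rewrite !mxE.
rewrite -mulrA -expr2 [LHS](det_block_adj A B C D); congr (_ * _).
have SE (i j : 'I_2) : (\det D *: A - B *m \adj D *m C) i j = schur n F i j.
  rewrite !mxE /schur -/D; congr (_ - _); apply: eq_bigr => l _.
  rewrite !mxE; congr (_ * _); by apply: eq_bigr => k _; rewrite !mxE.
move: (_ *: A - _) SE => T SE.
rewrite (expand_det_row _ ord0) !big_ord_recl big_ord0 /cofactor !det_mx11 !mxE !SE.
rewrite /= /bump /=. ring.
Qed.
End Jacobi.

(* Adding an indeterminate to the diagonal of the central block makes it
   nonsingular, so that Schur complements can be used. *)
Theorem desnanot_jacobi (R : idomainType) n (F : nat -> nat -> R) :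
  \det (fun_mx n.+2 F) * \det (fun_mx n (fun k l => F k.+2 l.+2))
  = \det (fun_mx n.+1 (fun i j => F (bump 0 i) (bump 0 j)))
    * \det (fun_mx n.+1 (fun i j => F (bump 1 i) (bump 1 j)))
    - \det (fun_mx n.+1 (fun i j => F (bump 0 i) (bump 1 j)))
      * \det (fun_mx n.+1 (fun i j => F (bump 1 i) (bump 0 j))).
Proof.
pose G i j : {poly R} := (F i j)%:P - ((i == j) && (1 < i)%N)%:R * 'X.
have G0 m (f g : nat -> nat) :
    (\det (fun_mx m (fun i j => G (f i) (g j)))).[0]
    = \det (fun_mx m (fun i j => F (f i) (g j))).
  rewrite -/(horner_eval 0 _) -det_map_mx; congr (\det _); apply/matrixP => i j.
  by rewrite !mxE /= /horner_eval /G hornerD hornerN hornerMX mulr0 subr0 hornerC.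
have D0 : \det (fun_mx n (fun k l => G k.+2 l.+2)) != 0.
  have -> : fun_mx n (fun k l => G k.+2 l.+2)
      = - char_poly_mx (fun_mx n (fun k l => F k.+2 l.+2)).
    apply/matrixP => i j; rewrite !mxE /G eqSS eqSS andbT opprB.
    by rewrite mulr_natl mulrb.
  rewrite -scaleN1r detZ mulf_neq0 ?expf_neq0 ?oppr_eq0 ?oner_eq0 //.
  exact/monic_neq0/char_poly_monic.
have := det_schur D0; rewrite -(det_skip_schur D0 (a := 1) (b := 1)) //.
rewrite -(det_skip_schur D0 (a := 0) (b := 0)) //.
rewrite -(det_skip_schur D0 (a := 1) (b := 0)) //.
rewrite -(det_skip_schur D0 (a := 0) (b := 1)) //.
move/(congr1 (horner^~ 0)); rewrite /= !hornerE.
rewrite !(G0 _ (bump _) (bump _)) (G0 _ id id).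
by rewrite (G0 _ (fun k => k.+2) (fun k => k.+2)) => ->; ring.
Qed.

Lemma difference_prod_neq0 (R : idomainType) n (r : nat -> R) :
    (forall i j, (i < n)%N -> (j < n)%N -> i != j -> r i != r j) ->
  difference_prod n r != 0.
Proof.
elim: n r => [|n IH] r ne_r /=; first exact: oner_neq0.
rewrite mulf_neq0 ?prodf_seq_neq0 ?IH //.
  apply/allP => j _; apply/implyP => _; rewrite subr_eq0.
  by apply: ne_r; rewrite // ltnS.
by move=> i j lt_i lt_j ne_ij; apply: ne_r.
Qed.

Lemma difference_prod2 (R : comNzRingType) n (r : nat -> R) :
  difference_prod n.+2 r * difference_prod n (fun k => r k.+2)
  = (r 0 - r 1) * difference_prod n.+1 (skip 0 r) * difference_prod n.+1 (skip 1 r).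
Proof. by rewrite /= big_ord_recl /skip /=; ring. Qed.

Lemma prod_border (R : comNzRingType) n (F : nat -> nat -> R) :
  \prod_(i < n.+1) \prod_(j < n.+1) F i j
  = F 0 0 * (\prod_(j < n) F 0 j.+1) * (\prod_(i < n) F i.+1 0)
    * \prod_(i < n) \prod_(j < n) F i.+1 j.+1.
Proof.
rewrite big_ord_recl big_ord_recl -!mulrA; congr (_ * (_ * _)).
by rewrite -big_split; apply: eq_bigr => i _; rewrite big_ord_recl.
Qed.

(** The Jacobi identity for the inverses of [vertex], each minor being turned into a partition
    function by [izergin_det]. Of the products of [vertex] there remain, for each pair of minors,
    the two among the four top left values that the pair misses; of the Vandermonde products, (r 0 -
    r 1)(s 0 - s 1). *)
Lemma sv_bilinear_field (K : fieldType) (x y : K) n (r s : nat -> K) :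
    y != 0 -> generic x y n.+2 r s ->
  y * (r 0 - r 1) * (s 0 - s 1) * sv_sum x y n.+2 r s
    * sv_sum x y n (fun k => r k.+2) (fun k => s k.+2)
  = vertex x y (r 0) (s 1) * vertex x y (r 1) (s 0)
    * sv_sum x y n.+1 (skip 0 r) (skip 0 s)
    * sv_sum x y n.+1 (skip 1 r) (skip 1 s)
  - vertex x y (r 0) (s 0) * vertex x y (r 1) (s 1)
    * sv_sum x y n.+1 (skip 0 r) (skip 1 s)
    * sv_sum x y n.+1 (skip 1 r) (skip 0 s).
Proof.
move=> y0 gen.
pose v i j := vertex x y (r i) (s j).
pose P n' (f g : nat -> nat) := \prod_(i < n') \prod_(j < n') v (f i) (g j).
have gen_skip a b : (a < 2)%N -> (b < 2)%N -> generic x y n.+1 (skip a r) (skip b s).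
  by move=> a2 b2; apply: generic_skip gen; lia.
have Pskip a b : (a < 2)%N -> (b < 2)%N ->
    P n.+1 (bump a) (bump b) = v (1 - a)%N (1 - b)%N
      * (\prod_(j < n) v (1 - a)%N j.+2) * (\prod_(i < n) v i.+2 (1 - b)%N)
      * P n (fun k => k.+2) (fun k => k.+2).
  by case: a => [|[]] // _; case: b => [|[]] // _;
    rewrite [LHS](prod_border n (fun i j => v (bump _ i) (bump _ j))).
have P2 : P n.+2 id id = v 0 0 * v 0 1 * v 1 0 * v 1 1
    * (\prod_(j < n) v 0 j.+2) * (\prod_(j < n) v 1 j.+2)
    * (\prod_(i < n) v i.+2 0) * (\prod_(i < n) v i.+2 1)
    * P n (fun k => k.+2) (fun k => k.+2).
  rewrite [LHS](prod_border n.+1 v) (prod_border n (fun i j => v i.+1 j.+1)).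
  rewrite big_ord_recl [\prod_(i < n.+1) _]big_ord_recl /=. rewrite /P. ring.
have izs a b (a2 : (a < 2)%N) (b2 : (b < 2)%N) :
  \det (fun_mx n.+1 (fun i j => (v (bump a i) (bump b j))^-1)) * P n.+1 (bump a) (bump b)
  = y ^+ 'C(n.+1, 2) * difference_prod n.+1 (skip a r)
    * difference_prod n.+1 (skip b s) * sv_sum x y n.+1 (skip a r) (skip b s).
  exact: izergin_det y0 (gen_skip a b a2 b2).
have iz2 : \det (fun_mx n.+2 (fun i j => (v i j)^-1)) * P n.+2 id id
  = y ^+ 'C(n.+2, 2) * difference_prod n.+2 r
    * difference_prod n.+2 s * sv_sum x y n.+2 r s.
  exact: izergin_det y0 gen.
have iz0 : \det (fun_mx n (fun i j => (v i.+2 j.+2)^-1))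
    * P n (fun k => k.+2) (fun k => k.+2)
  = y ^+ 'C(n, 2) * difference_prod n (fun k => r k.+2)
    * difference_prod n (fun k => s k.+2)
    * sv_sum x y n (fun k => r k.+2) (fun k => s k.+2).
  apply: izergin_det y0 _.
  exact: generic_skip (isT : (0 < n.+1)%N) (isT : (0 < n.+1)%N)
    (generic_skip (isT : (0 < n.+2)%N) (isT : (0 < n.+2)%N) gen).
have jac := desnanot_jacobi n (fun i j => (v i j)^-1).
have V0 (f : nat -> K) a : (a < 2)%N ->
    (forall i j, (i < n.+2)%N -> (j < n.+2)%N -> i != j -> f i != f j) ->
    difference_prod n.+1 (skip a f) != 0.
  move=> a2 ne_f; apply: difference_prod_neq0 => i j lt_i lt_j ne_ij.
  by apply: ne_f; rewrite ?bump_ltn ?(inj_eq (can_inj (bumpK _))) //; lia.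
have c0 : y ^+ 'C(n.+1, 2) ^+ 2
   * (difference_prod n.+1 (skip 0 r) * difference_prod n.+1 (skip 1 r))
   * (difference_prod n.+1 (skip 0 s) * difference_prod n.+1 (skip 1 s)) != 0.
  have Vr a a2 := V0 r a a2 (gen_row gen).
  have Vs a a2 := V0 s a a2 (gen_col gen).
  apply: mulf_neq0; last exact: mulf_neq0 (Vs 0 isT) (Vs 1 isT).
  by apply: mulf_neq0 (mulf_neq0 (Vr 0 isT) (Vr 1 isT)); rewrite !expf_neq0.
apply: (mulfI c0).
(* The exponents differ by one, whence the single factor y in the relation. *)
have ey : y ^+ 'C(n.+2, 2) * y ^+ 'C(n, 2) = y ^+ 'C(n.+1, 2) ^+ 2 * y.
  by rewrite -exprM -exprSr -exprD !binS !bin1 !bin0; congr (y ^+ _); lia.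
transitivity ((y ^+ 'C(n.+2, 2) * y ^+ 'C(n, 2))
  * (difference_prod n.+2 r * difference_prod n (fun k => r k.+2))
  * (difference_prod n.+2 s * difference_prod n (fun k => s k.+2))
  * sv_sum x y n.+2 r s * sv_sum x y n (fun k => r k.+2) (fun k => s k.+2)).
  rewrite ey !difference_prod2; ring.
transitivity ((\det (fun_mx n.+2 (fun i j => (v i j)^-1)) * P n.+2 id id)
   * (\det (fun_mx n (fun i j => (v i.+2 j.+2)^-1))
      * P n (fun k => k.+2) (fun k => k.+2))).
  rewrite iz2 iz0; ring.
transitivity ((\det (fun_mx n.+2 (fun i j => (v i j)^-1))
      * \det (fun_mx n (fun i j => (v i.+2 j.+2)^-1)))
    * (P n.+2 id id * P n (fun k => k.+2) (fun k => k.+2))); first by ring.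
rewrite jac.
have e00 := izs 0 0 isT isT; have e01 := izs 0 1 isT isT.
have e10 := izs 1 0 isT isT; have e11 := izs 1 1 isT isT.
transitivity (v 0 1 * v 1 0
  * (y ^+ 'C(n.+1, 2) * difference_prod n.+1 (skip 0 r)
    * difference_prod n.+1 (skip 0 s) * sv_sum x y n.+1 (skip 0 r) (skip 0 s))
  * (y ^+ 'C(n.+1, 2) * difference_prod n.+1 (skip 1 r)
    * difference_prod n.+1 (skip 1 s) * sv_sum x y n.+1 (skip 1 r) (skip 1 s))
  - v 0 0 * v 1 1
  * (y ^+ 'C(n.+1, 2) * difference_prod n.+1 (skip 0 r)
    * difference_prod n.+1 (skip 1 s) * sv_sum x y n.+1 (skip 0 r) (skip 1 s))
  * (y ^+ 'C(n.+1, 2) * difference_prod n.+1 (skip 1 r)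
    * difference_prod n.+1 (skip 0 s) * sv_sum x y n.+1 (skip 1 r) (skip 0 s))).
  rewrite -e00 -e01 -e10 -e11 !Pskip // P2 /=. ring.
rewrite /v; ring.
Qed.

Lemma eq_sv_sum (R : comNzRingType) (x y : R) n r r' s s' :
    (forall i, (i < n)%N -> r i = r' i) -> (forall j, (j < n)%N -> s j = s' j) ->
  sv_sum x y n r s = sv_sum x y n r' s'.
Proof.
move=> er es; apply: eq_state_sum => i j b h u lt_i.
by rewrite size_nseq => lt_j; rewrite er ?es.
Qed.

(** * From fields to integral domains, and the homogeneous limit *)

Section Morphism.
Variables (A B : comNzRingType) (phi : {rmorphism A -> B}).

Definition rmorph_sv :=
  (rmorphM, rmorphB, rmorphN, rmorphD, rmorphXn, rmorph1, rmorph0).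

Lemma sv_sum_morph x y n r s :
  phi (sv_sum x y n r s)
  = sv_sum (phi x) (phi y) n (fun i => phi (r i)) (fun j => phi (s j)).
Proof.
rewrite [LHS]state_sum_morph; apply: eq_state_sum => i j b h u _ _.
rewrite /sv_weight /six_weight /alpha /beta /gamma.
by case: b; case: h; case: u => /=; rewrite !rmorph_sv.
Qed.
End Morphism.

Lemma vertex_morph (A B : idomainType) (phi : {rmorphism A -> B}) x y r s :
  phi (vertex x y r s) = vertex (phi x) (phi y) (phi r) (phi s).
Proof. by rewrite /vertex /alpha /beta !rmorph_sv. Qed.

Lemma crossing_morph (A B : idomainType) (phi : {rmorphism A -> B}) x y r s :
  phi (crossing x y r s) = crossing (phi x) (phi y) (phi r) (phi s).
Proof. by rewrite /crossing !rmorph_sv. Qed.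

(** Genericity says that certain polynomial expressions do not vanish, so it passes from [psi] to
    any morphism whose kernel is smaller. *)
Lemma generic_transfer (A B C : idomainType)
    (phi : {rmorphism A -> B}) (psi : {rmorphism A -> C}) x y n r s :
    (forall p, psi p != 0 -> phi p != 0) ->
    generic (psi x) (psi y) n (fun i => psi (r i)) (fun j => psi (s j)) ->
  generic (phi x) (phi y) n (fun i => phi (r i)) (fun j => phi (s j)).
Proof.
move=> nz [gv gp gr gc gx]; split=> [i j|i|i j|i j|i j] *.
- by rewrite -vertex_morph nz // vertex_morph gv.
- have := gp i; rewrite -(rmorph1 psi) -(rmorph1 phi) -!rmorphB -!rmorphM -!rmorphD.
  by move=> gpi; rewrite nz ?gpi.
- by rewrite -subr_eq0 -rmorphB nz // rmorphB subr_eq0 gr.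
- by rewrite -subr_eq0 -rmorphB nz // rmorphB subr_eq0 gc.
by rewrite -crossing_morph nz // crossing_morph gx.
Qed.

(** The relation holds in the fraction field, where [psi] certifies genericity, and comes back
    because [tofrac] is injective. *)
Lemma sv_bilinear (A C : idomainType) (psi : {rmorphism A -> C}) x y n r s :
    psi y != 0 ->
    generic (psi x) (psi y) n.+2 (fun i => psi (r i)) (fun j => psi (s j)) ->
  y * (r 0 - r 1) * (s 0 - s 1) * sv_sum x y n.+2 r s
    * sv_sum x y n (fun k => r k.+2) (fun k => s k.+2)
  = vertex x y (r 0) (s 1) * vertex x y (r 1) (s 0)
    * sv_sum x y n.+1 (skip 0 r) (skip 0 s)
    * sv_sum x y n.+1 (skip 1 r) (skip 1 s)
  - vertex x y (r 0) (s 0) * vertex x y (r 1) (s 1)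
    * sv_sum x y n.+1 (skip 0 r) (skip 1 s)
    * sv_sum x y n.+1 (skip 1 r) (skip 0 s).
Proof.
move=> y0 gen.
have nz p : psi p != 0 -> @tofrac A p != 0.
  by rewrite tofrac_eq0; apply: contra_neq => ->; rewrite rmorph0.
have := sv_bilinear_field (nz _ y0) (generic_transfer nz gen).
rewrite -!sv_sum_morph -!vertex_morph -!rmorphB -!rmorphM -!rmorphB.
by move/eqP; rewrite tofrac_eq => /eqP.
Qed.

(* The homogeneous parameters are perturbed to 1 + 2t, 1 + 3t, ..., so that the
   determinant formula applies, and then t is set to 0; [psi], followed by the
   evaluation at t = 2, witnesses genericity. *)
Lemma sv_bilinear_homogeneous (A : idomainType) (psi : {rmorphism A -> int})
    (x y z1 z2 z3 : A) n :
    psi x = 0 -> psi y = 1 -> psi z1 = 1 -> psi z2 = 3 -> psi z3 = 3 ->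
  let one : nat -> A := fun=> 1 in
  y * (z1 - z2) * (z3 - 1)
    * sv_sum x y n.+2 (scons z1 (scons z2 one)) (scons z3 one)
    * sv_sum x y n one one
  = vertex x y z1 1 * vertex x y z2 z3
    * sv_sum x y n.+1 (scons z2 one) one
    * sv_sum x y n.+1 (scons z1 one) (scons z3 one)
  - vertex x y z1 z3 * vertex x y z2 1
    * sv_sum x y n.+1 (scons z2 one) (scons z3 one)
    * sv_sum x y n.+1 (scons z1 one) one.
Proof.
move=> psix psiy psi1 psi2 psi3 one.
have [psit [psitC psitX]] : exists psit : {rmorphism {poly A} -> int},
    (forall a, psit a%:P = psi a) /\ psit 'X = 2.
  exists (horner_eval (2 : int) \o map_poly psi)%FUN; split=> [a|] /=.
    by rewrite /horner_eval map_polyC hornerC.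
  by rewrite /horner_eval map_polyX hornerX.
(* With t = 2 the rows become 1, 3, 5, ... and the columns 3, 5, 7, ...; at x = 0 and y = 1,
   [generic] holds as soon as these are positive and distinct within each family. *)
pose near i : {poly A} := 1 + i.+2%:R * 'X.
pose r := scons z1%:P (scons z2%:P near).
pose s := scons z3%:P near.
have psit_near i : psit (near i) = 1 + i.+2%:Z * 2.
  by rewrite /near rmorphD rmorphM rmorph1 rmorph_nat psitX [i.+2%:R]natz.
have psi_r i : psit (r i) = (i + i).+1%:Z.
  case: i => [|[|i]]; rewrite /r /= ?psitC ?psi1 ?psi2 //.
  by rewrite psit_near; lia.
have psi_s i : psit (s i) = (i + i).+3%:Z.
  by case: i => [|i]; rewrite /s /= ?psitC ?psi3 // psit_near; lia.
have gen : generic (psit x%:P) (psit y%:P) n.+2 (fun i => psit (r i)) (fun j => psit (s j)).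
  rewrite !psitC psix psiy; split=> [i j|i|i j|i j|i j] *;
    rewrite ?psi_r ?psi_s /vertex /alpha /beta /crossing; try lia.
pose at0 : {rmorphism {poly A} -> A} := horner_eval 0.
have at0C a : at0 a%:P = a by rewrite /at0 /= /horner_eval hornerC.
have at0_near i : at0 (near i) = 1.
  by rewrite /near rmorphD rmorphM rmorph1 /at0 /= /horner_eval hornerX mulr0 addr0.
have at0_sum m (f g : nat -> {poly A}) f' g' :
    (forall i, at0 (f i) = f' i) -> (forall j, at0 (g j) = g' j) ->
  at0 (sv_sum x%:P y%:P m f g) = sv_sum x y m f' g'.
  by move=> ef eg; rewrite sv_sum_morph !at0C; apply: eq_sv_sum.
have y0 : psit y%:P != 0 by rewrite psitC psiy.
have at0_eq u1 u2 u3 u4 u5 v1 v2 v3 v4 w1 w2 w3 w4 :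
    u1 * u2 * u3 * u4 * u5 = v1 * v2 * v3 * v4 - w1 * w2 * w3 * w4 ->
    at0 u1 * at0 u2 * at0 u3 * at0 u4 * at0 u5
    = at0 v1 * at0 v2 * at0 v3 * at0 v4 - at0 w1 * at0 w2 * at0 w3 * at0 w4.
  by move=> e; rewrite -!rmorphM e rmorphB !rmorphM.
have := at0_eq _ _ _ _ _ _ _ _ _ _ _ _ _ (sv_bilinear y0 gen).
rewrite !vertex_morph.
rewrite (at0_sum _ _ _ (scons z1 (scons z2 one)) (scons z3 one)); first last.
- by case=> [|j]; rewrite /s /= ?at0C ?at0_near.
- by case=> [|[|j]]; rewrite /r /= ?at0C ?at0_near.
rewrite (at0_sum _ _ _ one one); try by move=> j; exact: at0_near.
rewrite (at0_sum _ _ _ (scons z2 one) one); first last.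
- by move=> j; exact: at0_near.
- by case=> [|j]; rewrite /skip /r /= ?at0C ?at0_near.
rewrite (at0_sum _ _ _ (scons z1 one) (scons z3 one)); first last.
- by case=> [|j]; rewrite /skip /s /= ?at0C ?at0_near.
- by case=> [|j]; rewrite /skip /r /= ?at0C ?at0_near.
rewrite (at0_sum _ _ _ (scons z2 one) (scons z3 one)); first last.
- by case=> [|j]; rewrite /skip /s /= ?at0C ?at0_near.
- by case=> [|j]; rewrite /skip /r /= ?at0C ?at0_near.
rewrite (at0_sum _ _ _ (scons z1 one) one); first last.
- by move=> j; exact: at0_near.
- by case=> [|j]; rewrite /skip /r /= ?at0C ?at0_near.
by rewrite !rmorphB /r /s /= !at0C at0_near.
Qed.

(** * Alternating sign matrices as states *)

Definition turn (h : bool) : int := if h then -1 else 1.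

(** An automaton whose state is the partial sum, 0 or 1: only the entry [turn h] may flip it, and it
    must end at 1. *)
Fixpoint alternates (h : bool) (s : seq int) : bool :=
  if s is e :: s' then
    if e == 0 then alternates h s' else (e == turn h) && alternates (~~ h) s'
  else h.

Lemma alternatesE h s :
  alternates h s
  = [&& all (mem asm_entries) s,
        path (fun a b : int => b == - a) (- turn h) [seq a <- s | a != 0]
      & h%:Z + \sum_(a <- s) a == 1].
Proof.
elim: s h => [|e s IH] h /=; first by rewrite big_nil; case: h.
rewrite big_cons; have [->|e0] /= := eqVneq e 0; first by rewrite IH add0r.
rewrite opprK IH !inE (negPf e0) /=.
have [->|_] := eqVneq e (turn h); last by rewrite andbF.
rewrite addrA; case: h => /=; rewrite ?opprK ?orbT ?eqxx //=.
Qed.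

Lemma path_sum_le (h : bool) (s : seq int) :
    all (mem asm_entries) s ->
    path (fun a b : int => b == - a) (- turn h) [seq a <- s | a != 0] ->
  h%:Z + \sum_(a <- s) a <= 1.
Proof.
elim: s h => [|e s IH] h /=; first by rewrite big_nil; case: h.
rewrite big_cons; have [->|e0] /= := eqVneq e 0; first by rewrite add0r; apply: IH.
rewrite opprK => /andP[_ s_ok] /andP[/eqP -> p_ok].
rewrite addrA; have := IH (~~ h) s_ok; rewrite /turn.
by case: h p_ok => /= p_ok /(_ p_ok).
Qed.

(** [sorted] alone would let the first nonzero entry be -1; by [path_sum_le] such a line sums to at
    most 0. *)
Lemma alternating_lineE s : alternating_line s = alternates false s.
Proof.
rewrite alternatesE add0r /alternating_line.
have [s_ok|//] := boolP (all _ s).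
have nz : all (fun a => a \in [:: 1; -1]) [seq a <- s | a != 0].
  apply/allP => a; rewrite mem_filter => /andP[a0 /(allP s_ok)].
  by rewrite !inE (negPf a0).
have := @path_sum_le true s s_ok; move: nz.
case: [seq a <- s | a != 0] => //= a t /andP[]; rewrite !inE opprK.
case/orP => /eqP -> //= _; case: path => //= le1; apply/negbTE.
by have := le1 isT; lia.
Qed.

Section Expansion.
Variable R : comNzRingType.

Fixpoint words n : seq (seq int) :=
  if n is n'.+1 then [seq e :: r | e <- asm_entries, r <- words n'] else [:: [::]].

Fixpoint matrices m n : seq (seq (seq int)) :=
  if m is m'.+1 then [seq r :: M | r <- words n, M <- matrices m' n]
  else [:: [::]].

Fixpoint row_weight (W : nat -> weight R) (us : seq bool) (h : bool) (r : seq int) : R :=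
  match us, r with
  | u :: us', e :: r' =>
    if e == 0 then W 0 false h u * row_weight (fun j => W j.+1) us' h r'
    else if (e == turn h) && (h == u) then
      W 0 true h u * row_weight (fun j => W j.+1) us' (~~ h) r'
    else 0
  | _, _ => h%:R
  end.

Fixpoint next_state (us : seq bool) (r : seq int) : seq bool :=
  match us, r with
  | u :: us', e :: r' => (u (+) (e != 0)) :: next_state us' r'
  | _, _ => [::]
  end.

Fixpoint matrix_weight (V : nat -> nat -> weight R) us M : R :=
  if M is r :: M' then
    row_weight (V 0) us false r
    * matrix_weight (fun i => V i.+1) (next_state us r) M'
  else (all id us)%:R.

Lemma row_op_expand W us h f :
  row_op W us h f
  = \sum_(r <- words (size us)) row_weight W us h r * f (next_state us r).
Proof.
elim: us W h f => [|u us IH] W h f; first by rewrite /= big_seq1.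
rewrite -[words _]/[seq e :: r | e <- asm_entries, r <- words (size us)].
rewrite big_allpairs_dep !big_cons big_nil /= !IH addr0 mulr_sumr.
congr (_ + _); first by apply: eq_bigr => r _; rewrite addbF mulrA.
have sum0 (g : seq int -> R) : \sum_(r <- words (size us)) 0 * g r = 0.
  by apply: big1 => r _; rewrite mul0r.
by case: h u => -[] /=; rewrite ?sum0 ?add0r ?addr0 // mulr_sumr;
  apply: eq_bigr => r _; rewrite mulrA.
Qed.

Lemma size_words n r : r \in words n -> size r = n.
Proof.
elim: n r => [|n IH] r; first by rewrite inE => /eqP ->.
by case/allpairsP => -[e w] [_ /= /IH <- ->].
Qed.

Lemma size_next_state us r : size us = size r -> size (next_state us r) = size us.
Proof. by elim: us r => [|u us IH] [|e r] //= [/IH ->]. Qed.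

Lemma state_sum_expand m V us :
  state_sum m V us = \sum_(M <- matrices m (size us)) matrix_weight V us M.
Proof.
elim: m V us => [|m IH] V us; first by rewrite /= big_seq1.
rewrite /= big_allpairs_dep row_op_expand big_seq [RHS]big_seq.
apply: eq_bigr => r /size_words sz_r.
by rewrite IH size_next_state // mulr_sumr.
Qed.

Lemma mem_words n r :
  (r \in words n) = (size r == n) && all (mem asm_entries) r.
Proof.
elim: n r => [|n IH] [|e r] //.
  by apply/negbTE/allpairsP => -[p [_ _ e]].
apply/idP/idP => [/allpairsP[[e' r'] [/= e'_ok r'_ok [-> ->]]]|].
  by move: r'_ok; rewrite IH => /andP[/eqP -> ->]; rewrite eqxx /= andbT.
move=> /andP[/eqP[sz] /andP[e_ok r_ok]]; apply/allpairsP.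
by exists (e, r); split=> //=; rewrite IH sz eqxx.
Qed.

Lemma uniq_words n : uniq (words n).
Proof.
elim: n => // n IH; apply: (@allpairs_uniq _ _ _ cons asm_entries (words n)) => //.
by move=> -[e r] [e' r'] _ _ /= [-> ->].
Qed.

Lemma mem_matrices m n M :
  (M \in matrices m n) = (size M == m) && all (mem (words n)) M.
Proof.
elim: m M => [|m IH] [|r M] //.
  by apply/negbTE/allpairsP => -[p [_ _ e]].
apply/idP/idP => [/allpairsP[[r' M'] [/= r'_ok M'_ok [-> ->]]]|].
  by move: M'_ok; rewrite IH => /andP[/eqP -> ->]; rewrite eqxx /= andbT.
move=> /andP[/eqP[sz] /andP[r_ok M_ok]]; apply/allpairsP.
by exists (r, M); split=> //=; rewrite IH sz eqxx.
Qed.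

Lemma uniq_matrices m n : uniq (matrices m n).
Proof.
elim: m => // m IH.
apply: (@allpairs_uniq _ _ _ cons (words n) (matrices m n)); rewrite ?uniq_words //.
by move=> -[e r] [e' r'] _ _ /= [-> ->].
Qed.

Definition rows_of n (A : 'M[int]_n) : seq (seq int) :=
  [seq [seq A i j | j <- enum 'I_n] | i <- enum 'I_n].

Lemma sum_matrices n (f : seq (seq int) -> R) :
  \sum_(M <- matrices n n) f M
  = \sum_(A <- [seq map_mx val B | B : 'M[seq_sub asm_entries]_n]) f (rows_of A).
Proof.
rewrite -[RHS](big_map (@rows_of n) xpredT f); apply: perm_big.
apply: uniq_perm; first exact: uniq_matrices.
  rewrite map_inj_in_uniq.
    rewrite map_inj_uniq ?enum_uniq // => B C /matrixP BC.
    by apply/matrixP => i j; apply: val_inj; have := BC i j; rewrite !mxE.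
  move=> A B _ _ AB; apply/matrixP => i j.
  have nthE (C : 'M[int]_n) : nth 0 (nth [::] (rows_of C) i) j = C i j.
    by rewrite (nth_map i) ?size_enum_ord // (nth_map j) ?size_enum_ord // !nth_ord_enum.
  by rewrite -nthE AB nthE.
move=> M; rewrite mem_matrices; apply/andP/mapP => [[/eqP sz_M M_ok]|].
  have e_ok (i j : 'I_n) : nth 0 (nth [::] M i) j \in asm_entries.
    have := allP M_ok (nth [::] M i); rewrite mem_nth ?sz_M // => /(_ isT).
    by rewrite inE mem_words => /andP[/eqP sz_r /allP]; apply; rewrite mem_nth ?sz_r.
  exists (\matrix_(i, j) nth 0 (nth [::] M i) j).
    apply/imageP; exists (\matrix_(i, j) SeqSub (e_ok i j)) => //.
    by apply/matrixP => i j; rewrite !mxE.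
  apply: (@eq_from_nth _ [::]) => [|i]; rewrite sz_M; first by rewrite size_map size_enum_ord.
  move=> lt_i.
  rewrite (nth_map (Ordinal lt_i)) ?size_enum_ord //.
  have := allP M_ok (nth [::] M i); rewrite mem_nth ?sz_M // => /(_ isT).
  rewrite inE mem_words => /andP[/eqP sz_r _].
  apply: (@eq_from_nth _ 0) => [|j]; rewrite sz_r; first by rewrite size_map size_enum_ord.
  move=> lt_j.
  rewrite (nth_map (Ordinal lt_j)) ?size_enum_ord // mxE.
  by rewrite (nth_ord_enum _ (Ordinal lt_i)) (nth_ord_enum _ (Ordinal lt_j)).
case=> A /imageP[B _ ->] ->; rewrite size_map size_enum_ord eqxx; split=> //.
apply/allP => r /mapP[i _ ->]; rewrite inE mem_words size_map size_enum_ord eqxx.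
by apply/allP => e /mapP[j _ ->]; rewrite mxE; apply: valP.
Qed.
End Expansion.

Lemma mkseq_recl (T : Type) (f : nat -> T) n :
  mkseq f n.+1 = f 0 :: mkseq (fun k => f k.+1) n.
Proof. by rewrite /mkseq /= (iotaDl 1 0) -map_comp. Qed.

(** On an alternating line the partial sums started from h are 0 or 1, and this is the state of
    [alternates] before position j. *)
Definition edge (h : bool) (F : nat -> int) j : bool :=
  h%:Z + \sum_(k < j) F k == 1.

Lemma edge0 h F : edge h F 0 = h.
Proof. by rewrite /edge big_ord0 addr0; case: h. Qed.

Lemma edgeS h F j :
    (F 0 != 0 -> F 0 == turn h) ->
  edge h F j.+1 = edge (h (+) (F 0 != 0)) (fun k => F k.+1) j.
Proof.
rewrite /edge big_ord_recl addrA; have [->|_ /(_ isT)/eqP ->] := eqVneq.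
  by rewrite addbF addr0.
by case: h.
Qed.

Section ClosedForm.
Variable R : comNzRingType.

Lemma row_weightE n (W : nat -> weight R) U h F :
  row_weight W (mkseq U n) h (mkseq F n)
  = if alternates h (mkseq F n)
       && \big[andb/true]_(j < n) ((F j != 0) ==> (F j == turn (U j)))
    then \prod_(j < n) W j (F j != 0) (edge h F j) (U j) else 0.
Proof.
elim: n W U h F => [|n IH] W U h F.
  by rewrite /= !big_ord0 andbT; case: h.
rewrite !mkseq_recl /= !IH !big_ord_recl /= edge0.
have turn_inj b c : (turn b == turn c) = (b == c) by case: b; case: c.
have [F0|F0] /= := eqVneq (F 0) 0.
  case: ifP => _; last by rewrite mulr0.
  congr (_ * _); apply: eq_bigr => j _; rewrite edgeS ?F0 ?eqxx //.
  by rewrite addbF.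
have [Fh|] := eqVneq (F 0) (turn h) => //=; rewrite Fh turn_inj.
have [_|] := eqVneq h (U 0) => /=; last by rewrite andbF.
case: ifP => _; last by rewrite mulr0.
congr (_ * _); apply: eq_bigr => j _; rewrite edgeS ?Fh ?eqxx //.
by rewrite -Fh F0 addbT.
Qed.

Lemma next_state_mkseq n U F :
  next_state (mkseq U n) (mkseq F n) = mkseq (fun j => U j (+) (F j != 0)) n.
Proof. by elim: n U F => // n IH U F; rewrite !mkseq_recl /= IH. Qed.

Lemma all_mkseq n U : all id (mkseq U n) = \big[andb/true]_(j < n) U j.
Proof.
by elim: n U => [|n IH] U; rewrite ?big_ord0 // mkseq_recl big_ord_recl /= IH.
Qed.

(** The compatibility with U in [row_weightE] is the first transition of every column automaton, so
    the column conditions build up row by row. *)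
Lemma matrix_weightE m n (V : nat -> nat -> weight R) U F :
  matrix_weight V (mkseq U n) (mkseq (fun i => mkseq (F i) n) m)
  = if \big[andb/true]_(i < m) alternates false (mkseq (F i) n)
       && \big[andb/true]_(j < n) alternates (U j) (mkseq (F^~ j) m)
    then \prod_(i < m) \prod_(j < n)
           V i j (F i j != 0) (edge false (F i) j) (edge (U j) (F^~ j) i)
    else 0.
Proof.
elim: m V U F => [|m IH] V U F.
  rewrite /= all_mkseq !big_ord0 /=.
  by rewrite (eq_bigr (fun j : 'I_n => U j)) //; case: (\big[_/_]_(_ < _) _).
rewrite mkseq_recl [LHS]/= row_weightE next_state_mkseq IH.
rewrite [in RHS](eq_bigr (fun j : 'I_n =>
  ((F 0 j != 0) ==> (F 0 j == turn (U j)))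
  && alternates (U j (+) (F 0 j != 0)) (mkseq (fun k => F k.+1 j) m))); last first.
  move=> j _; rewrite mkseq_recl /=; case: (eqVneq (F 0 j) 0) => _ /=.
    by rewrite addbF.
  by rewrite addbT.
rewrite big_split [in RHS]big_ord_recl [in X in _ = if _ then X else _]big_ord_recl /=.
set c0 := alternates _ _; set cs := \big[_/_]_(_ < n) (_ ==> _).
set c1 := \big[andb/true]_(_ < m) _; set c2 := \big[andb/true]_(_ < n) _.
rewrite andbACA; have [/andP[_]|] := boolP (c0 && cs); last by rewrite mul0r.
rewrite /cs big_andE => /forallP cs_ok /=; case: ifP => _; last by rewrite mulr0.

congr (_ * _).
  by apply: eq_bigr => j _; rewrite edge0.
apply: eq_bigr => i _; apply: eq_bigr => j _.
rewrite -[bump 0 i]/(i.+1) [edge (U j) _ _]edgeS //.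
by move: (cs_ok j) => /= /implyP.
Qed.

Lemma sum_prefix n (f : 'I_n.+1 -> int) (j : 'I_n.+1) :
  \sum_(k < j) f (inord k) = \sum_(k < n.+1 | (k < j)%N) f k.
Proof.
rewrite (big_ord_widen n.+1 (fun k => f (inord k))) ?(ltnW (ltn_ord j)) //.
by apply: eq_bigr => k _; rewrite inord_val.
Qed.

Definition row_prefix n (A : 'M[int]_n) i (j : 'I_n) : int :=
  \sum_(k < n | (k < j)%N) A i k.
Definition col_prefix n (A : 'M[int]_n) (i : 'I_n) j : int :=
  \sum_(k < n | (k < i)%N) A k j.

Theorem dwbc_ASM n (V : nat -> nat -> weight R) :
  dwbc n.+1 V
  = \sum_(A <- ASM n.+1) \prod_(i < n.+1) \prod_(j < n.+1)
      V i j (A i j != 0) (row_prefix A i j == 1) (col_prefix A i j == 1).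
Proof.
rewrite /dwbc state_sum_expand size_nseq sum_matrices big_filter [RHS]big_mkcond.
apply: eq_bigr => A _.
pose F i j : int := A (inord i) (inord j).
have map_mkseq (T : Type) (g : 'I_n.+1 -> T) :
    [seq g j | j <- enum 'I_n.+1] = mkseq (fun j => g (inord j)) n.+1.
  rewrite /mkseq -val_enum_ord -map_comp.
  by apply: eq_map => j /=; rewrite inord_val.
have -> : rows_of A = mkseq (fun i => mkseq (F i) n.+1) n.+1.
  by rewrite /rows_of map_mkseq; apply: eq_map => i; rewrite map_mkseq.
have -> : nseq n.+1 false = mkseq (fun=> false) n.+1.
  apply: (@eq_from_nth _ true) => [|i]; rewrite size_nseq ?size_mkseq // => lt_i.
  by rewrite nth_nseq nth_mkseq lt_i.
rewrite matrix_weightE !big_andE.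
have -> : is_asm A = [forall i : 'I_n.+1, alternates false (mkseq (F i) n.+1)]
    && [forall j : 'I_n.+1, alternates false (mkseq (F^~ j) n.+1)].
  congr (_ && _); apply: eq_forallb => i;
    rewrite alternating_lineE map_mkseq; congr (alternates _ _);
    by apply: eq_mkseq => k; rewrite /F inord_val.
case: ifP => // _; apply: eq_bigr => i _; apply: eq_bigr => j _.
rewrite /edge !add0r /F /row_prefix /col_prefix.
rewrite (sum_prefix (fun k => A (inord i) k)) (sum_prefix (fun k => A k (inord j))).
by rewrite !inord_val.
Qed.
End ClosedForm.

Lemma alternates_edge n h F :
    alternates h (mkseq F n) ->
  [/\ forall j, (j <= n)%N -> h%:Z + \sum_(k < j) F k = (edge h F j)%:Z,
      forall j, (j < n)%N -> F j != 0 -> F j = turn (edge h F j)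
    & edge h F n].
Proof.
elim: n h F => [|n IH] h F.
  rewrite /= => h1; split=> // [[|//]|]; last by rewrite edge0.
  by rewrite edge0 big_ord0 addr0.
rewrite mkseq_recl /= => altF.
have F0 : F 0 != 0 -> F 0 == turn h.
  by move: altF; case: (F 0 == 0) => // /andP[].
have {altF}/IH [sumF turnF endF] : alternates (h (+) (F 0 != 0)) (mkseq (fun k => F k.+1) n).
  by move: altF; case: (F 0 == 0) => /=; rewrite ?addbF ?addbT // => /andP[].
split=> [[|j]|[|j]|]; rewrite ?edge0 ?edgeS //.
- by rewrite big_ord0 addr0.
- move=> lt_j; rewrite -sumF // big_ord_recl addrA; congr (_ + _).
  have [->|/F0/eqP ->] := eqVneq (F 0) 0; first by rewrite addr0 addbF.
  by case: (h).
- by move=> _ /F0/eqP.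
by apply: turnF.
Qed.

Lemma is_asm_tr n (A : 'M[int]_n) : is_asm A^T = is_asm A.
Proof.
rewrite /is_asm andbC; congr (_ && _); apply: eq_forallb => i;
  by congr alternating_line; apply: eq_map => j; rewrite mxE.
Qed.

Lemma col_prefix_tr n (A : 'M[int]_n) i j : col_prefix A i j = row_prefix A^T j i.
Proof. by apply: eq_bigr => k _; rewrite mxE. Qed.

Section AsmEntries.
Variables (n : nat) (A : 'M[int]_n.+1).
Hypothesis asmA : is_asm A.

Lemma asm_row i :
  [/\ forall j, row_prefix A i j = (row_prefix A i j == 1)%:Z,
      forall j, A i j != 0 -> A i j = turn (row_prefix A i j == 1)
    & \sum_j A i j = 1].
Proof.
pose F k := A i (inord k).
have : alternates false (mkseq F n.+1).
  have /andP[/forallP/(_ i) + _] := asmA; rewrite alternating_lineE.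
  rewrite /mkseq -val_enum_ord -map_comp; congr (alternates _ _).
  by apply: eq_map => j /=; rewrite /F inord_val.
have prefixE (j : 'I_n.+1) : row_prefix A i j = 0 + \sum_(k < j) F k.
  by rewrite add0r (sum_prefix (A i)).
case/alternates_edge=> sumF turnF /eqP endF; split=> [j|j|].
- by rewrite {1}prefixE sumF ?(ltnW (ltn_ord j)) // /edge -prefixE.
- by move: (turnF j (ltn_ord j)); rewrite /edge -prefixE /F inord_val.
by rewrite -endF add0r; apply: eq_bigr => j _; rewrite /F inord_val.
Qed.
End AsmEntries.

(** * The statistics as counts of zeros with given bits *)

Section Statistics.
Variables (n : nat) (A : 'M[int]_n.+1).
Hypothesis asmA : is_asm A.
Let r i j := row_prefix A i j == 1.
Let c i j := col_prefix A i j == 1.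

Lemma asm_col j :
  [/\ forall i, col_prefix A i j = (c i j)%:Z,
      forall i, A i j != 0 -> A i j = turn (c i j)
    & \sum_i A i j = 1].
Proof.
have asmAt : is_asm A^T by rewrite is_asm_tr.
have [e1 e2 e3] := asm_row asmAt j; split=> [i|i|].
- by rewrite /c !col_prefix_tr {1}e1.
- by have := e2 i; rewrite mxE /c col_prefix_tr.
by rewrite -e3; apply: eq_bigr => i _; rewrite mxE.
Qed.

Lemma asm_cell i j : A i j = 0 \/ A i j = turn (r i j) /\ r i j = c i j.
Proof.
have [_ er _] := asm_row asmA i; have [_ ec _] := asm_col j.
have [|A0] := eqVneq (A i j) 0; [by left | right].
have := er _ A0; rewrite (ec _ A0) -/(r i j) => e; split=> //.
by move: e; case: (r i j); case: (c i j).
Qed.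

Lemma row_prefix_last i : row_prefix A i ord_max + A i ord_max = 1.
Proof.
have [_ _ <-] := asm_row asmA i; rewrite [RHS](bigD1 ord_max) //= addrC.
congr (_ + _); apply: eq_bigl => k.
by rewrite -val_eqE /= ltn_neqAle -ltnS ltn_ord andbT.
Qed.

Lemma col_prefix_last j : col_prefix A ord_max j + A ord_max j = 1.
Proof.
have [_ _ <-] := asm_col j; rewrite [RHS](bigD1 ord_max) //= addrC.
congr (_ + _); apply: eq_bigl => k.
by rewrite -val_eqE /= ltn_neqAle -ltnS ltn_ord andbT.
Qed.

Lemma row_prefix0 i : row_prefix A i ord0 = 0.
Proof. by rewrite /row_prefix big_pred0. Qed.

Lemma col_prefix0 j : col_prefix A ord0 j = 0.
Proof. by rewrite /col_prefix big_pred0. Qed.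

(** Grouping by the row of the lower entry and the column of the upper one gives the sum over the
    cells of c (r + A i j). A nonzero entry contributes nothing: either c = 0, or r = 1 and the
    entry is -1. *)
Lemma nu_cells :
  nu A = \sum_i \sum_j ([&& A i j == 0, r i j & c i j] : nat)%:Z.
Proof.
rewrite /nu (exchange_big_dep xpredT) //=; apply: eq_bigr => i _.
rewrite exchange_big /=; apply: eq_bigr => j _.
transitivity (col_prefix A i j * (row_prefix A i j + A i j)).
  rewrite mulr_suml; apply: eq_bigr => i' _.
  rewrite /row_prefix mulrDr mulr_sumr (bigD1 j) //= addrC; congr (_ + _).
  by apply: eq_bigl => k; rewrite [RHS]ltn_neqAle andbC.
have [er _ _] := asm_row asmA i; have [ec _ _] := asm_col j.
rewrite er ec -/(r i j) -/(c i j).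
by case: (asm_cell i j) => [->|[-> <-]]; case: (r i j); case: (c i j).
Qed.

Lemma absz_nu :
  `|nu A|%N = (\sum_i \sum_j [&& A i j == 0%R, r i j & c i j])%N.
Proof.
rewrite nu_cells -[RHS]/(`|Posz _|%N); congr absz.
rewrite -natz natr_sum; apply: eq_bigr => i _.
by rewrite natr_sum; apply: eq_bigr => j _; rewrite natz.
Qed.
End Statistics.

Lemma unit_vector n (f : 'I_n -> int) :
    (forall j, f j = (f j == 1)%:Z) -> \sum_j f j = 1 ->
  exists j0, forall j, f j = (j == j0)%:Z.
Proof.
move=> f01 sum_f.
have [j0 fj0|f0] := pickP (fun j => f j == 1); last first.
  by move: sum_f; rewrite big1 // => j _; rewrite f01 f0.
exists j0 => j; have [->|ne_j] := eqVneq j j0; first exact/eqP.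
move: sum_f; rewrite (bigD1 j0) //= (eqP fj0) (bigD1 j) //= => /eqP.
have : 0 <= \sum_(i < n | (i != j0) && (i != j)) f i.
  by apply: Num.Theory.sumr_ge0 => i _; rewrite f01.
move: (\sum_(i < n | _) f i) => S; rewrite (f01 j) => S0.
by case: (f j == 1) => // S1; move: S0; lia.
Qed.

Lemma unit_vector_prefix n (f : 'I_n -> int) j0 (k : 'I_n) :
    (forall j, f j = (j == j0)%:Z) ->
  \sum_(j < n | (j < k)%N) f j = (j0 < k)%N%:Z.
Proof.
move=> fE; case: ltnP => [lt_j0k|le_kj0].
  rewrite (bigD1 j0) //= fE eqxx big1 ?addr0 // => j /andP[_ /negPf ne_j].
  by rewrite fE ne_j.
apply: big1 => j lt_jk; rewrite fE; case: eqP lt_jk => // ->.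
by rewrite ltnNge le_kj0.
Qed.

(** The zeros to which [six_weight] gives [b] or [x * b]; on a border line they are those counted by
    its statistic [rho]. *)
Definition balanced n (A : 'M[int]_n) i j : bool :=
  (A i j == 0) && ((row_prefix A i j == 1) == (col_prefix A i j == 1)).

Lemma balanced_tr n (A : 'M[int]_n) i j : balanced A^T i j = balanced A j i.
Proof.
rewrite /balanced mxE -col_prefix_tr [col_prefix A^T _ _]col_prefix_tr trmxK.
by rewrite eq_sym [_ == (_ == 1)]eq_sym.
Qed.

Lemma exists_unit n (f : 'I_n -> int) j0 (P : pred 'I_n) :
  (forall j, f j = (j == j0)%:Z) -> [exists j, (f j == 1) && P j] = P j0.
Proof.
move=> fE; apply/existsP/idP => [[j /andP[]]|Pj0].
  by rewrite fE; case: (eqVneq j j0) => [->|].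
by exists j0; rewrite fE eqxx.
Qed.

(** The column bits are all 0 in the top row, so balanced zeros have row bit 0 and lie before the
    1. *)
Lemma rho_T_balanced n (A : 'M[int]_n.+1) :
  is_asm A -> rho_T A = #|[set j | balanced A ord0 j]|.
Proof.
move=> asmA; have [_ _ sumA] := asm_row asmA ord0.
have A01 j : A ord0 j = (A ord0 j == 1)%:Z.
  case: (asm_cell asmA ord0 j) => [->//|[e ec]]; move: e; rewrite ec col_prefix0.
  by move=> ->.
have [j0 AE] := unit_vector A01 sumA.
congr #|pred_of_set _|; apply/setP => k; rewrite !inE (exists_unit _ AE) /balanced.
rewrite col_prefix0 /row_prefix (unit_vector_prefix _ AE) AE.
case: (eqVneq k j0) => //= ne; rewrite ltn_neqAle leqNgt.
by case: ltnP => /=; rewrite ?andbF ?andbT // => _; rewrite val_eqE.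
Qed.

(** Since columns sum to 1, a zero in the bottom row has column bit 1, so balanced zeros lie after
    the 1. *)
Lemma rho_B_balanced n (A : 'M[int]_n.+1) :
  is_asm A -> rho_B A = #|[set j | balanced A ord_max j]|.
Proof.
move=> asmA; have [_ _ sumA] := asm_row asmA ord_max.
have A1 j : A ord_max j = 1 - (col_prefix A ord_max j == 1)%:Z.
  have [<- _ _] := asm_col asmA j.
  by rewrite -(col_prefix_last asmA j) addrC addKr.
have A01 j : A ord_max j = (A ord_max j == 1)%:Z.
  by rewrite A1; case: (col_prefix _ _ _ == 1).
have [j0 AE] := unit_vector A01 sumA.
congr #|pred_of_set _|; apply/setP => k; rewrite !inE (exists_unit _ AE) /balanced.
rewrite /row_prefix (unit_vector_prefix _ AE).
by rewrite A1; case: (col_prefix _ _ _ == 1) => //=; case: ltnP.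
Qed.

Lemma rho_L_balanced n (A : 'M[int]_n.+1) :
  is_asm A -> rho_L A = #|[set i | balanced A i ord0]|.
Proof.
rewrite -is_asm_tr => /rho_T_balanced asmA.
transitivity (rho_T A^T); last first.
  by rewrite asmA; congr #|pred_of_set _|; apply/setP => i; rewrite !inE balanced_tr.
congr #|pred_of_set _|; apply/setP => k; rewrite !inE mxE; congr (_ && _).
by apply: eq_existsb => i; rewrite mxE.
Qed.

Lemma rho_R_balanced n (A : 'M[int]_n.+1) :
  is_asm A -> rho_R A = #|[set i | balanced A i ord_max]|.
Proof.
rewrite -is_asm_tr => /rho_B_balanced asmA.
transitivity (rho_B A^T); last first.
  by rewrite asmA; congr #|pred_of_set _|; apply/setP => i; rewrite !inE balanced_tr.
congr #|pred_of_set _|; apply/setP => k; rewrite !inE mxE; congr (_ && _).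
by apply: eq_existsb => i; rewrite mxE.
Qed.

Section Bridge.
Variable R : comNzRingType.

(** A product, so that for n = 0 the only line is both first and last. *)
Definition boundary n (a b : R) (i : nat) : R :=
  (if i == 0%N then a else 1) * (if i == n then b else 1).

Lemma prod_one_row n (P : 'I_n -> 'I_n -> bool) i0 (z : R) :
  \prod_i \prod_j (if P i j then (if i == i0 then z else 1) else 1)
  = z ^+ #|[set j | P i0 j]|.
Proof.
rewrite (bigD1 i0) //= [X in _ * X]big1 => [|i /negPf ne_i]; last first.
  by rewrite big1 // => j _; rewrite ne_i; case: ifP.
by rewrite eqxx mulr1 -big_mkcond prodr_const cardsE.
Qed.

Lemma prod_boundary n (P : 'I_n.+1 -> 'I_n.+1 -> bool) (a b : R) :
  \prod_(i < n.+1) \prod_(j < n.+1) (if P i j then boundary n a b i else 1)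
  = a ^+ #|[set j | P ord0 j]| * b ^+ #|[set j | P ord_max j]|.
Proof.
rewrite -!prod_one_row -big_split; apply: eq_bigr => i _.
rewrite -big_split; apply: eq_bigr => j _ /=.
by rewrite /boundary -!val_eqE; case: ifP; rewrite ?mulr1.
Qed.

Lemma six_weight_split (x p q c : R) b h u :
  six_weight x 1 (p * q) c b h u
  = (if [&& ~~ b, h & u] then x else 1) * (if b && h then c else 1)
    * (if ~~ b && (h == u) then p else 1) * (if ~~ b && (h == u) then q else 1).
Proof. by rewrite /six_weight; case: b; case: h; case: u; rewrite /=; ring. Qed.

(** No -1 lies on the border, so [c] is free there; this absorbs the values of [gamma] on the
    refined lines. *)
Theorem Z_quad_dwbc n (x y z1 z2 z3 z4 : R) (c : nat -> nat -> R) :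
    (forall i j, (0 < i < n)%N -> (0 < j < n)%N -> c i j = y) ->
  Z_quad n.+1 x y z1 z2 z3 z4
  = dwbc n.+1 (fun i j =>
      six_weight x 1 (boundary n z1 z3 i * boundary n z4 z2 j) (c i j)).
Proof.
move=> cE; rewrite dwbc_ASM /= big_seq [RHS]big_seq; apply: eq_bigr => A.
rewrite mem_ASM => asmA.
transitivity (\prod_(i < n.+1) \prod_(j < n.+1)
   ((x ^+ [&& A i j == 0, row_prefix A i j == 1 & col_prefix A i j == 1]
     * (if A i j == -1 then y else 1))
    * ((if balanced A i j then boundary n z1 z3 i else 1)
       * (if balanced A i j then boundary n z4 z2 j else 1)))); last first.
  apply: eq_bigr => i _; apply: eq_bigr => j _; rewrite six_weight_split negbK.
  rewrite -/(balanced A i j) -!mulrA; congr (_ * (_ * _)).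
    by case: [&& _, _ & _].
  have [_ er _] := asm_row asmA i.
  have [A1|] := eqVneq (A i j) (-1).
    have := er j; rewrite A1 => /(_ isT) => {er}.
    case r1: (row_prefix A i j == 1) => //= _; rewrite cE //.
      have c1 : col_prefix A i j == 1.
        case: (asm_cell asmA i j) => [A0|[_ <-]]; last by rewrite r1.
        by rewrite A0 in A1.
      apply/andP; split.
        rewrite lt0n; apply/eqP => i0; move: c1.
        by rewrite (_ : i = ord0) ?col_prefix0 //; apply: val_inj.
      rewrite ltn_neqAle -ltnS ltn_ord andbT; apply/eqP => i_n.
      have ei : i = ord_max by apply: val_inj.
      have := col_prefix_last asmA j; rewrite -ei A1 (eqP c1).
      by [].
    apply/andP; split.
      rewrite lt0n; apply/eqP => j0; move: r1.
      by rewrite (_ : j = ord0) ?row_prefix0 //; apply: val_inj.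
    rewrite ltn_neqAle -ltnS ltn_ord andbT; apply/eqP => j_n.
    have ej : j = ord_max by apply: val_inj.
    by have := row_prefix_last asmA i; rewrite -ej A1 (eqP r1).
  have [->//|/er ->] := eqVneq (A i j) 0.
  by case: (row_prefix A i j == 1).
rewrite (eq_bigr _ (fun i _ => big_split _ _ _ _ _)) big_split /=.
rewrite !(eq_bigr _ (fun i _ => big_split _ _ _ _ _)) !big_split /=.
rewrite prod_boundary [X in _ * (_ * X)]exchange_big /=.
rewrite (prod_boundary (fun j i => balanced A i j)).
rewrite (eq_bigr _ (fun i _ => prodrXr _ _ _ _)) prodrXr -absz_nu //.
rewrite pair_bigA /= -big_mkcond prodr_const.
rewrite rho_T_balanced // rho_R_balanced // rho_B_balanced // rho_L_balanced //.
rewrite /mu cardsE; ring.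
Qed.
End Bridge.

(** * Symmetry, gauge and corner corrections *)

Definition rot180 n (A : 'M[int]_n) : 'M[int]_n :=
  \matrix_(i, j) A (rev_ord i) (rev_ord j).

Lemma rot180K n : involutive (@rot180 n).
Proof. by move=> A; apply/matrixP => i j; rewrite !mxE !rev_ordK. Qed.

Lemma alternating_line_rev s : alternating_line (rev s) = alternating_line s.
Proof.
rewrite /alternating_line all_rev filter_rev rev_sorted; congr [&& _, _ & _].
  by apply: eq_sorted => a b /=; rewrite eq_sym eqr_oppLR.
by rewrite (perm_big s) // perm_rev.
Qed.

Lemma map_rev_ord (T : Type) n (f : 'I_n -> T) :
  [seq f (rev_ord j) | j <- enum 'I_n] = rev [seq f j | j <- enum 'I_n].
Proof.
rewrite -map_rev (map_comp f (@rev_ord n)); congr map.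
apply: (inj_map val_inj); apply: (@eq_from_nth _ 0%N).
  by rewrite map_rev size_rev 3!size_map.
move=> i; rewrite 2!size_map size_enum_ord => lt_i.
have lt_ri : (n - i.+1 < n)%N by lia.
rewrite -map_comp map_rev nth_rev size_map size_enum_ord //.
rewrite val_enum_ord nth_iota // add0n.
by rewrite (nth_map (Ordinal lt_i)) ?size_enum_ord //= nth_enum_ord.
Qed.

Lemma is_asm_rot180 n (A : 'M[int]_n) : is_asm (rot180 A) = is_asm A.
Proof.
have row_rot (B : 'M[int]_n) i : [seq (rot180 B) i j | j <- enum 'I_n]
    = rev [seq B (rev_ord i) j | j <- enum 'I_n].
  by rewrite -map_rev_ord; apply: eq_map => j; rewrite mxE.
have col_rot (B : 'M[int]_n) j : [seq (rot180 B) i j | i <- enum 'I_n]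
    = rev [seq B i (rev_ord j) | i <- enum 'I_n].
  by rewrite -(map_rev_ord (B^~ _)); apply: eq_map => i; rewrite mxE.
rewrite /is_asm; congr (_ && _); apply/forallP/forallP => asm i.
- by have := asm (rev_ord i); rewrite row_rot rev_ordK alternating_line_rev.
- by rewrite row_rot alternating_line_rev.
- by have := asm (rev_ord i); rewrite col_rot rev_ordK alternating_line_rev.
by rewrite col_rot alternating_line_rev.
Qed.

Lemma rev_ord_lt n (i j : 'I_n) : (rev_ord i < rev_ord j)%N = (j < i)%N.
Proof. by have := ltn_ord i; have := ltn_ord j; rewrite /=; lia. Qed.

Lemma nu_rot180 n (A : 'M[int]_n) : nu (rot180 A) = nu A.
Proof.
rewrite /nu (reindex_inj rev_ord_inj) /=.
rewrite (eq_bigr (fun i : 'I_n => \sum_(i' < n | (i' < i)%N)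
   \sum_(j < n) \sum_(j' < n | (j <= j')%N) A i j * A i' j')).
  rewrite (exchange_big_dep xpredT) //=; apply: eq_bigr => i _; apply: eq_bigr => i' _.
  rewrite (exchange_big_dep xpredT) //=; apply: eq_bigr => j _; apply: eq_bigr => j' _.
  exact: mulrC.
move=> i _; rewrite (reindex_inj rev_ord_inj) /=.
apply: eq_big => [i'|i' _]; first exact: rev_ord_lt.
rewrite (reindex_inj rev_ord_inj); apply: eq_bigr => j _.
rewrite (reindex_inj rev_ord_inj); apply: eq_big => [j'|j' _].
  by rewrite leqNgt rev_ord_lt -leqNgt.
by rewrite !mxE !rev_ordK.
Qed.

Lemma mu_rot180 n (A : 'M[int]_n) : mu (rot180 A) = mu A.
Proof.
pose f (p : 'I_n * 'I_n) := (rev_ord p.1, rev_ord p.2).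
have f_inj : injective f.
  by apply: (can_inj (g := f)) => -[i j]; rewrite /f /= !rev_ordK.
rewrite /mu -(card_preimset _ f_inj); apply: eq_card => p.
by rewrite !inE mxE !rev_ordK.
Qed.

Lemma card_rev_ord n (P Q : pred 'I_n) :
  (forall k, P (rev_ord k) = Q k) -> #|[set k | P k]| = #|[set k | Q k]|.
Proof.
move=> PQ; rewrite -(card_preimset _ (@rev_ord_inj n)); apply: eq_card => k.
by rewrite !inE PQ.
Qed.

Lemma exists_rev_ord n (P Q : pred 'I_n) :
  (forall k, P (rev_ord k) = Q k) -> [exists k, P k] = [exists k, Q k].
Proof.
move=> PQ; apply/existsP/existsP => -[k Pk]; exists (rev_ord k).
  by rewrite -PQ rev_ordK.
by rewrite PQ.
Qed.

Lemma rev_ord0 n : rev_ord (@ord0 n) = ord_max.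
Proof. by apply: val_inj; rewrite /= subn1. Qed.

Lemma rev_ord_max n : rev_ord (@ord_max n) = ord0.
Proof. by apply: val_inj; rewrite /= subnn. Qed.

Lemma rho_rot180 n (A : 'M[int]_n.+1) :
  [/\ rho_T (rot180 A) = rho_B A, rho_R (rot180 A) = rho_L A,
      rho_B (rot180 A) = rho_T A & rho_L (rot180 A) = rho_R A].
Proof.
by split; apply: card_rev_ord => k; rewrite mxE rev_ordK ?rev_ord0 ?rev_ord_max;
  congr (_ && _); apply: exists_rev_ord => l;
  rewrite mxE rev_ordK ?rev_ord0 ?rev_ord_max; congr (_ && _); rewrite rev_ord_lt.
Qed.

(** Freezing the top left corner leaves a function refined along the bottom row, and z1 = 1 leaves
    one refined along the bottom row and left column; the half-turn turns them into [Z_ref] and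
    [Z_adj_tilde]. *)
Lemma Z_quad_rot180 (R : comNzRingType) n (x y z1 z2 z3 z4 : R) :
  Z_quad n x y z1 z2 z3 z4 = Z_quad n x y z3 z4 z1 z2.
Proof.
case: n => // n; rewrite /= (perm_big [seq rot180 A | A <- ASM n.+1]) /=.
  rewrite big_map; apply: eq_bigr => A _.
  have [-> -> -> ->] := rho_rot180 A; rewrite nu_rot180 mu_rot180.
  by rewrite -!mulrA; congr (_ * (_ * _)); rewrite mulrA mulrC -mulrA.
apply: uniq_perm; rewrite ?map_inj_uniq ?ASM_uniq //; first exact: inv_inj (@rot180K _).
move=> A; rewrite mem_ASM; apply/idP/mapP => [asmA|[B asmB ->]].
  by exists (rot180 A); rewrite ?rot180K // mem_ASM is_asm_rot180.
by rewrite is_asm_rot180 -mem_ASM.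
Qed.

Section Gauge.
Variable R : comNzRingType.

(** A factor y on every entry would give y to the length of the row. Here the -1s carry y^2 and the
    1s nothing; as a row ending at [true] has [~~ h] more 1s than -1s, it lacks y to that power. *)
Lemma row_op_gauge (y : R) (W W' : nat -> weight R) us h f :
    (forall j h u, W' j false h u = y * W j false h u) ->
    (forall j u, W' j true false u = W j true false u) ->
    (forall j u, W' j true true u = y ^+ 2 * W j true true u) ->
  y ^+ (~~ h) * row_op W' us h f = y ^+ size us * row_op W us h f.
Proof.
move=> e0 e1 e2; elim: us W W' h f e0 e1 e2 => [|u us IH] W W' h f e0 e1 e2 /=.
  by case: h; rewrite ?mul0r ?mulr0.
have {}IH h' f' : y ^+ (~~ h') * row_op (fun j => W' j.+1) us h' f'
    = y ^+ size us * row_op (fun j => W j.+1) us h' f'.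
  exact: IH.
have := IH h (fun d => f (u :: d)); have := IH (~~ h) (fun d => f (~~ u :: d)).
move: (row_op _ us h _) (row_op _ us (~~ h) _) (row_op _ us h _) (row_op _ us (~~ h) _).
move=> p q r s; rewrite e0 exprS.
case: h => /=; rewrite expr0 expr1 !mul1r => es er; case: u => /=; rewrite ?addr0.
- transitivity (y * W 0 false true true * r + y * W 0 true true true * (y * s)).
    by rewrite e2; ring.
  rewrite es er; ring.
- rewrite er; ring.
- transitivity (y * W 0 false false true * (y * r)); first by ring.
  rewrite er; ring.
transitivity (y * W 0 false false false * (y * r) + y * W 0 true false false * s).
  by rewrite e1; ring.
rewrite es er; ring.
Qed.

Lemma state_sum_gauge (y : R) m (V V' : nat -> nat -> weight R) us :
    (forall i j h u, V' i j false h u = y * V i j false h u) ->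
    (forall i j u, V' i j true false u = V i j true false u) ->
    (forall i j u, V' i j true true u = y ^+ 2 * V i j true true u) ->
  y ^+ m * state_sum m V' us = y ^+ (m * size us) * state_sum m V us.
Proof.
move=> e0 e1 e2; elim: m V V' us e0 e1 e2 => [|m IH] V V' us e0 e1 e2 //=.
have gauge0 := @row_op_gauge y (V 0) (V' 0) us false
  (state_sum m (fun i => V' i.+1)) (e0 0) (e1 0) (e2 0).
rewrite exprSr -mulrA -[X in X * row_op _ _ _ _]expr1 [X in _ * X]gauge0.
rewrite mulSn exprD -mulrA mulrCA; congr (_ * _); rewrite -!row_opZ.
apply: eq_row_opr => d sz_d; rewrite -sz_d; apply: IH => *.
- by rewrite e0.
- by rewrite e1.
by rewrite e2.
Qed.

Lemma dwbc_gauge (x y : R) n (a b c : nat -> nat -> R) :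
  y ^+ n * dwbc n (fun i j =>
             six_weight x (y * a i j) (y * b i j) (y ^+ 2 * c i j))
  = y ^+ (n * n) * dwbc n (fun i j => six_weight x (a i j) (b i j) (c i j)).
Proof.
rewrite /dwbc (@state_sum_gauge y n (fun i j => six_weight x (a i j) (b i j) (c i j)));
  rewrite ?size_nseq //.
by move=> i j [] []; rewrite /six_weight //= mulrCA.
Qed.
End Gauge.

Section Homogeneous.
Variables (R : idomainType) (x y : R).
Hypothesis y0 : y != 0.

Lemma gamma1 : gamma x y 1 = y.
Proof. by rewrite /gamma; ring. Qed.

Lemma boundary1 n (z : R) i : boundary n z 1 i = if i == 0%N then z else 1.
Proof. by rewrite /boundary; case: (i == n); rewrite mulr1. Qed.

Lemma dwbc_rows n (z1 z2 : R) (V : nat -> nat -> weight R) :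
    (forall i j b h u, (i < n.+1)%N -> V i j b h u
       = six_weight x y (y * boundary n z1 z2 i)
           (y ^+ 2 * gamma x y (boundary n z1 z2 i)) b h u) ->
  dwbc n.+1 V = y ^+ (n.+1 * n) * Z_quad n.+1 x y z1 1 z2 1.
Proof.
move=> eV; apply: (mulfI (expf_neq0 n.+1 y0)).
rewrite (@Z_quad_dwbc _ _ _ _ _ _ _ _ (fun i j => gamma x y (boundary n z1 z2 i))).
  rewrite mulrA -exprD -mulnS -(dwbc_gauge x y n.+1 (fun _ _ => 1)).
  congr (_ * _); apply: eq_state_sum => i j b h u lt_i _; rewrite eV //.
  by rewrite boundary1 if_same !mulr1.
move=> i j /andP[i0 i_n] _; rewrite /boundary (gtn_eqF i0) (ltn_eqF i_n) mulr1.
exact: gamma1.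
Qed.

Lemma sv_sum_row n (z : R) :
  sv_sum x y n.+1 (scons z (fun=> 1)) (fun=> 1)
  = y ^+ (n.+1 * n) * Z_ref n.+1 x y z.
Proof.
rewrite /Z_ref; apply: dwbc_rows => i j b h u _.
rewrite boundary1 (_ : (if i == 0%N then z else 1) = scons z (fun=> 1) i); last by case: i.
by rewrite /sv_weight; congr (six_weight _ _ _ _ b h u);
  rewrite /alpha /beta ?gamma1; ring.
Qed.

(** Up to the gauge, the two models differ only in the weights of a zero at the left corners: [b]
    and [a] instead of y z1 z3 and y. Eliminating [U] between the two instances of [dwbc_corners]
    gives the formula. The first bracket counts the matrices with no 1 at a left corner, and the
    last two terms those with a 1 at the upper or at the lower one. *)
Lemma sv_sum_corners n (z1 z2 z3 : R) :
  let a := alpha x y z2 z3 in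
  let b := beta y z1 z3 in
  let C := (x * z2 * z3) ^+ n.+1 in
  y * z1 * z3
    * sv_sum x y n.+2 (boundary n.+1 z1 z2) (boundary n.+1 z3 1)
  = y ^+ (n.+1 * n.+1 + n)
    * (b * a * (Z_tri n.+2 x y z1 z2 z3 - Z_ref n.+1 x y z2
                - z1 * C * Z_ref n.+1 x y z1)
       + y * z1 * z3 * a * Z_ref n.+1 x y z2
       + y * z1 * b * C * Z_ref n.+1 x y z1).
Proof.
move=> a b C.
pose r := boundary n.+1 z1 z2; pose s := boundary n.+1 z3 1.
have r1 i : i != 0%N -> i != n.+1 -> r i = 1.
  by rewrite /r /boundary => /negPf -> /negPf ->; rewrite mulr1.
have s1 j : j != 0%N -> s j = 1 by rewrite /s boundary1 => /negPf ->.
pose c i j := if j == 0%N then gamma x y (s j) else gamma x y (r i).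
pose V i j := six_weight x (y * 1) (y * (r i * s j)) (y ^+ 2 * c i j).
have [U eU] := dwbc_corners n V.
have eZ : dwbc n.+2 V = y ^+ (n.+2 * n.+1) * Z_tri n.+2 x y z1 z2 z3.
  apply: (mulfI (expf_neq0 n.+2 y0)).
  rewrite dwbc_gauge mulrA -exprD -mulnS; congr (_ * _).
  rewrite /Z_tri (@Z_quad_dwbc _ _ _ _ _ _ _ _ c) //.
  move=> i j /andP[i0 i_n] /andP[j_0 j_n]; rewrite /c gtn_eqF // r1 ?gamma1 //.
    by rewrite -lt0n.
  by rewrite neq_ltn i_n.
have eV1 : dwbc n.+1 (fun i j => V i.+1 j.+1) = y ^+ (n.+1 * n) * Z_ref n.+1 x y z2.
  rewrite /Z_ref Z_quad_rot180; apply: dwbc_rows => i j b' h u _.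
  have -> : boundary n 1 z2 i = r i.+1.
    by rewrite /r /boundary eqSS /= if_same mul1r.
  by rewrite /V /c s1 //= !mulr1.
have eV2 : dwbc n.+1 (fun i j => V i j.+1) = y ^+ (n.+1 * n) * Z_ref n.+1 x y z1.
  rewrite /Z_ref; apply: dwbc_rows => i j b' h u lt_i.
  have -> : boundary n z1 1 i = r i.
    by rewrite boundary1 /r /boundary (ltn_eqF lt_i) mulr1.
  by rewrite /V /c s1 //= !mulr1.
have r0 : r 0 = z1 by rewrite /r /boundary mulr1.
have rn : r n.+1 = z2 by rewrite /r /boundary /= eqxx mul1r.
have s0 : s 0 = z3 by rewrite /s boundary1.
have prod_y m : \prod_(i < m) (y * 1) = y ^+ m.
  by rewrite prodr_const card_ord mulr1.
have prod_b : \prod_(i < n) (y * (r i.+1 * s 0)) = (y * z3) ^+ n.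
  rewrite -[in RHS](card_ord n) -prodr_const; apply: eq_bigr => i _.
  by rewrite r1 ?s0 ?mul1r // eqSS ltn_eqF.
have prod_c : \prod_(j < n.+1) (x * (y * (r n.+1 * s j.+1))) = (x * (y * z2)) ^+ n.+1.
  rewrite -[in RHS](card_ord n.+1) -prodr_const; apply: eq_bigr => j _.
  by rewrite rn s1 // mulr1.
have eV : y ^+ (n.+2 * n.+1) * Z_tri n.+2 x y z1 z2 z3
    = y * (z1 * z3) * y * U
      + y * (y ^+ n.+1 * y ^+ n * (y ^+ (n.+1 * n) * Z_ref n.+1 x y z2))
      + y * (z1 * z3) * ((y * z3) ^+ n * (x * (y * z2)) ^+ n.+1
                         * (y ^+ (n.+1 * n) * Z_ref n.+1 x y z1)).
  rewrite -eZ (eU V) // eV1 eV2 /V /six_weight /= !prod_y prod_b prod_c.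
  by rewrite r0 s0 mulr1 !mul1r.
have eS : sv_sum x y n.+2 r s
    = b * a * U
      + a * (y ^+ n.+1 * y ^+ n * (y ^+ (n.+1 * n) * Z_ref n.+1 x y z2))
      + b * ((y * z3) ^+ n * (x * (y * z2)) ^+ n.+1
             * (y ^+ (n.+1 * n) * Z_ref n.+1 x y z1)).
  rewrite /sv_sum eU // => [|i j ij]; last first.
    have [j0|j0] := eqVneq j 0.
      have ri : r i = 1.
        by move: ij; rewrite j0 !inE orbF negb_or => /andP[]; apply: r1.
      rewrite /sv_weight /V /c j0 eqxx ri.
      by congr (six_weight _ _ _ _); rewrite /alpha /beta ?gamma1; ring.
    rewrite /sv_weight /V /c (negPf j0) s1 //.
    by congr (six_weight _ _ _ _); rewrite /alpha /beta ?gamma1; ring.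
  rewrite eV1 eV2 /V /sv_weight /six_weight /= !prod_y prod_b prod_c.
  by rewrite r0 rn s0 !mul1r.
have eU' : y * (z1 * z3) * y * U = y ^+ (n.+2 * n.+1) * Z_tri n.+2 x y z1 z2 z3
      - y * (y ^+ n.+1 * y ^+ n * (y ^+ (n.+1 * n) * Z_ref n.+1 x y z2))
      - y * (z1 * z3) * ((y * z3) ^+ n * (x * (y * z2)) ^+ n.+1
                         * (y ^+ (n.+1 * n) * Z_ref n.+1 x y z1)).
  by rewrite eV; ring.
apply: (mulfI y0); rewrite [LHS](_ : _ = b * a * (y * (z1 * z3) * y * U)
  + y * y * z1 * z3 * (a * (y ^+ n.+1 * y ^+ n * (y ^+ (n.+1 * n) * Z_ref n.+1 x y z2))
      + b * ((y * z3) ^+ n * (x * (y * z2)) ^+ n.+1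
             * (y ^+ (n.+1 * n) * Z_ref n.+1 x y z1)))); last by rewrite eS; ring.
rewrite eU' /C (_ : (n.+2 * n.+1 = (n.+1 * n) + n + n + 2)%N); last by ring.
rewrite (_ : (n.+1 * n.+1 + n = (n.+1 * n) + n + n + 1)%N); last by ring.
rewrite !exprMn !exprS !exprD.
move: (y ^+ (n.+1 * n)) (y ^+ n) (x ^+ n) (z2 ^+ n) (z3 ^+ n) => Y Yn Xn Z2n Z3n.
ring.
Qed.
End Homogeneous.

(** * The relation between the refined generating functions *)

Section RowOrder.
Variables (R : idomainType) (x y : R).
Hypothesis crossing_neq0 : forall r r' : R, crossing x y r r' != 0.
Let one : nat -> R := fun=> 1.

Lemma sv_sum_second_row n (z1 z2 : R) r s :
  sv_sum x y n.+2 (scons z1 (scons z2 r)) s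
  = sv_sum x y n.+2 (scons z2 (scons z1 r)) s.
Proof.
rewrite (@sv_sum_front _ _ _ n.+2 1) // => j k _ _ _; exact: mulfI.
Qed.

Lemma sv_sum_last_row n (z1 z2 : R) s :
  sv_sum x y n.+2 (boundary n.+1 z1 z2) s
  = sv_sum x y n.+2 (scons z1 (scons z2 one)) s.
Proof.
rewrite (@sv_sum_front _ _ _ n.+2 n.+1) // => [|j k _ _ _]; last exact: mulfI.
rewrite -[RHS]sv_sum_second_row; apply: eq_sv_sum => // -[|[|k]] lt_k //=.
- by rewrite /boundary eqxx mul1r.
- by rewrite /skip /boundary mulr1.
have -> : skip n.+1 (boundary n.+1 z1 z2) k.+1 = boundary n.+1 z1 z2 k.+1.
  by rewrite /skip /bump ltnNge (_ : (k.+1 <= n)%N).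
by rewrite /boundary /= ltn_eqF // mul1r.
Qed.

End RowOrder.

Lemma sv_sum_first_col (R : idomainType) (x y z : R) n r :
  sv_sum x y n.+1 r (boundary n z 1) = sv_sum x y n.+1 r (scons z (fun=> 1)).
Proof. by apply: eq_sv_sum => // -[|j] _; rewrite boundary1. Qed.

(* [psi] only serves to show that the factors to be cancelled are nonzero and
   that the parameters are generic. *)
Lemma triply_refined (R : idomainType) (psi : {rmorphism R -> int})
    n (x y z1 z2 z3 : R) :
    psi x = 0 -> psi y = 1 -> psi z1 = 1 -> psi z2 = 3 -> psi z3 = 3 ->
  (z2 - z1) * (z3 - 1) * Z_tri n.+3 x y z1 z2 z3 * Z_unref n.+1 x y =
    ((z2 - 1) * (z3 - 1) - y * z2 * z3) * z1
      * Z_adj n.+2 x y z1 z3 * Z_ref n.+2 x y z2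
  - (x * (z1 - 1) * (z3 - 1) - y) * z1 * z2 * z3
      * Z_adj_tilde n.+2 x y z2 z3 * Z_ref n.+2 x y z1
  - (z1 - 1) * (z3 - 1) * z2 * Z_ref n.+2 x y z2 * Z_unref n.+1 x y
  + (z2 - 1) * (z3 - 1) * z1 * (x * z2 * z3) ^+ n.+2
      * Z_ref n.+2 x y z1 * Z_unref n.+1 x y.
Proof.
move=> psix psiy psi1 psi2 psi3.
have nz p : psi p != 0 -> p != 0 by apply: contra_neq => ->; rewrite rmorph0.
have y0 : y != 0 by rewrite nz ?psiy.
have crossing0 r r' : crossing x y r r' != 0.
  apply: nz; rewrite crossing_morph psix psiy.
  by rewrite (_ : crossing 0 1 _ _ = 1) // /crossing; ring.
pose one : nat -> R := fun=> 1.
have a0 : alpha x y z2 z3 != 0.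
  by apply: nz; rewrite /alpha !rmorph_sv psix psiy psi2 psi3.
have b0 : beta y z1 z3 != 0.
  by apply: nz; rewrite /beta !rmorph_sv psiy psi1 psi3.
have bil := sv_bilinear_homogeneous n.+1 psix psiy psi1 psi2 psi3.
cbv zeta in bil; rewrite -!/one in bil.
have e3 := sv_sum_corners x y0 n.+1 z1 z2 z3.
cbv zeta in e3; rewrite sv_sum_first_col (sv_sum_last_row crossing0) in e3.
(* With z2 = 1, respectively z1 = 1, only one corner is a crossing of two refined lines, and the
   correction of the other one cancels. *)
have ea := sv_sum_corners x y0 n z1 1 z3.
have eb := sv_sum_corners x y0 n 1 z2 z3.
cbv zeta in ea; rewrite sv_sum_first_col (sv_sum_last_row crossing0) in ea.
cbv zeta in eb; rewrite sv_sum_first_col (sv_sum_last_row crossing0) in eb.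
have ee z s : sv_sum x y n.+2 (scons z (scons 1 one)) s = sv_sum x y n.+2 (scons z one) s.
  by apply: eq_sv_sum => // -[|[|]].
rewrite ee in ea; rewrite (sv_sum_second_row crossing0) ee in eb.
have eu : sv_sum x y n.+1 one one = y ^+ (n.+1 * n) * Z_unref n.+1 x y.
  by rewrite -[Z_unref _ _ _]/(Z_ref _ _ _ 1) -sv_sum_row //; apply: eq_sv_sum => // -[].
rewrite !sv_sum_row // eu in bil.
have tilde : Z_tri n.+2 x y 1 z2 z3 = Z_adj_tilde n.+2 x y z2 z3.
  by rewrite /Z_tri Z_quad_rot180.
rewrite tilde in eb.
rewrite -[Z_tri n.+2 x y z1 1 z3]/(Z_adj n.+2 x y z1 z3) in ea.
rewrite -![Z_ref n.+1 x y 1]/(Z_unref n.+1 x y) in ea eb.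
have alpha1 z : alpha x y 1 z = y by rewrite /alpha; ring.
have alpha1' z : alpha x y z 1 = y by rewrite /alpha; ring.
have beta1 z : beta y 1 z = y * z by rewrite /beta; ring.
have beta1' z : beta y z 1 = y * z by rewrite /beta; ring.
rewrite /vertex !alpha1' !beta1' in bil.
rewrite alpha1 in ea; rewrite beta1 in eb.
have beta23 : beta y z2 z3 = y * z2 * z3 - (z2 - 1) * (z3 - 1) by [].
have alpha13 : alpha x y z1 z3 = y - x * (z1 - 1) * (z3 - 1) by [].
rewrite beta23 alpha13 in bil.
have aE : alpha x y z2 z3 = y - x * (z2 - 1) * (z3 - 1) by [].
have bE : beta y z1 z3 = y * z1 * z3 - (z1 - 1) * (z3 - 1) by [].
move: (alpha x y z2 z3) (beta y z1 z3) aE bE a0 b0 e3 ea eb bil => a b aE bE a0 b0.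
move: (sv_sum x y n.+3 _ _) (sv_sum x y n.+2 _ _) (sv_sum x y n.+2 _ _) => S3 Sa Sb.
move: (Z_tri _ _ _ _ _ _) (Z_adj _ _ _ _ _) (Z_adj_tilde _ _ _ _ _)
  (Z_unref _ _ _) (Z_ref n.+2 x y z1) (Z_ref n.+2 x y z2)
  (Z_ref n.+1 x y z1) (Z_ref n.+1 x y z2) => Zt Za Zb Zu Zr1 Zr2 Zs1 Zs2.
have -> : (n.+2 * n.+2 + n.+1 = n.+1 * n + n * 4 + 5)%N by ring.
have -> : (n.+2 * n.+1 = n.+1 * n + n * 2 + 2)%N by ring.
have -> : (n.+1 * n.+1 + n = n.+1 * n + n * 2 + 1)%N by ring.
move: (n.+1 * n)%N => N.
rewrite mulr1 !mul1r !exprD [y ^+ (n * 4)]exprM [y ^+ (n * 2)]exprM [_ ^+ n.+2]exprS.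
move: (y ^+ N) (expf_neq0 N y0) => q q0.
move: (y ^+ n) (expf_neq0 n y0) => t t0.
move: ((x * z2 * z3) ^+ n.+1) ((x * z3) ^+ n.+1) => C C1 e3 ea eb bil.
have F0 : a * b * (q ^+ 2 * t ^+ 4 * y ^+ 6) != 0 by rewrite !mulf_neq0 ?expf_neq0.
(* Multiplied by y z1 z3, the relation involves exactly the multiples of S3, Sa and Sb that are
   known from [sv_sum_corners]. *)
have {}bil : y * (z1 - z2) * (z3 - 1) * (y * z1 * z3 * S3) * (q * Zu)
  = y * (y * z1) * (a * (y * z2 * z3 - (z2 - 1) * (z3 - 1)))
    * (q * t ^+ 2 * y ^+ 2 * Zr2) * (y * z1 * z3 * Sb)
  - (y - x * (z1 - 1) * (z3 - 1)) * b * (y * (y * z2)) * (z1 * (y * 1 * z3 * Sa))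
    * (q * t ^+ 2 * y ^+ 2 * Zr1).
  transitivity (y * z1 * z3 * (y * (z1 - z2) * (z3 - 1) * S3 * (q * Zu))); first by ring.
  by rewrite bil; ring.
rewrite e3 ea eb in bil; apply: (mulfI F0); apply: subr0_eq.
(* The goal times the factor in [F0] is the difference of the two sides of [bil], so 0 is written as
   the left side minus itself and one copy is replaced. *)
rewrite -[RHS](subrr (y * (z1 - z2) * (z3 - 1) * (q * t ^+ 4 * y ^+ 5
  * (b * a * (Zt - Zr2 - z1 * (x * z2 * z3 * C) * Zr1)
     + y * z1 * z3 * a * Zr2 + y * z1 * b * (x * z2 * z3 * C) * Zr1)) * (q * Zu))).
rewrite {1}bil aE bE; ring.
Qed.

Theorem corollary2 (n : nat) (hn : (3 <= n)%N) :
  let x  : {mpoly int[5]} := 'X_(inord 0) in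
  let y  : {mpoly int[5]} := 'X_(inord 1) in
  let z1 : {mpoly int[5]} := 'X_(inord 2) in
  let z2 : {mpoly int[5]} := 'X_(inord 3) in
  let z3 : {mpoly int[5]} := 'X_(inord 4) in
  (z2 - z1) * (z3 - 1) * Z_tri n x y z1 z2 z3 * Z_unref (n - 2) x y =
    ((z2 - 1) * (z3 - 1) - y * z2 * z3) * z1
      * Z_adj (n - 1) x y z1 z3 * Z_ref (n - 1) x y z2
  - (x * (z1 - 1) * (z3 - 1) - y) * z1 * z2 * z3
      * Z_adj_tilde (n - 1) x y z2 z3 * Z_ref (n - 1) x y z1
  - (z1 - 1) * (z3 - 1) * z2 * Z_ref (n - 1) x y z2 * Z_unref (n - 2) x y
  + (z2 - 1) * (z3 - 1) * z1 * (x * z2 * z3) ^+ (n - 1)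
      * Z_ref (n - 1) x y z1 * Z_unref (n - 2) x y.
Proof.
case: n hn => [|[|[|n]]] // _ x y z1 z2 z3; rewrite subn2 subn1 /=.
(* The values of x, y, z1, z2, z3: the rows z1, z2 start the progression 1, 3, 5, ... and the column
   z3 starts 3, 5, 7, ... *)
pose v (i : 'I_5) : int := nth 0 [:: 0; 1; 1; 3; 3] i.
have vX k : (k < 5)%N -> meval v 'X_(inord k) = nth 0 [:: 0; 1; 1; 3; 3] k.
  by move=> lt_k; rewrite mevalXU /v inordK.
by apply: (@triply_refined _ (meval v) n x y z1 z2 z3); exact: vX.
Qed.
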